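(* Let $\mathcal P$ be a collection of sublinear symmetric functions $p:L^1\to\overline{\mathbb R}$, let $\mathcal U:=\bigcap_{p\in\mathcal P}\operatorname{dom}p$ be endowed with the locally convex topology generated by $\mathcal P$, and assume that (A1), (A2) and (A3) of the context hold. Let $\mathcal Y$, $\mathcal M$, $\mathcal M^s$ and $(L^\infty)^\perp$ be as defined in the context. Then the topological dual of $\mathcal U$ is \[ \mathcal U^*=\mathcal Y\oplus\mathcal M^s\oplus(L^\infty)^\perp \] in the sense that for every $u^*\in\mathcal U^*$ there exist unique $y\in\mathcal Y$, $m^s\in\mathcal M^s$ and $w\in(L^\infty)^\perp$ such that \[ \langle u,u^*\rangle=E[u\cdot y]+\int_\Omega u\,dm^s+\langle u,w\rangle\qquad\forall u\in\mathcal U, \] and conversely every such triple defines an element of $\mathcal U^*$ by this formula. For every $u\in\mathcal U$ and $m\in\mathcal M$ (and $p\in\mathcal P$ with $p^\circ(m)<\infty$), \[ \int_\Omega u\,dm\le p(u)\,p^\circ(m). \] Given $w\in(L^\infty)^\perp$ and $u\in\mathcal U$, there exists a decreasing sequence $(A^\nu)_{\nu=1}^\infty\subset\mathcal F$ with $P(A^\nu)\searrow0$ and \[ \langle u,w\rangle=\langle u1_{A^\nu},w\rangle\qquad\forall\nu=1,2,\ldots. \] If every $p\in\mathcal P$ satisfies (A4), then $\mathcal M^s=\{0\}$; if every $p\in\mathcal P$ satisfies (A5), then $(L^\infty)^\perp=\{0\}$.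
   Context: $(\Omega,\mathcal F,P)$ is a probability space, $n\ge1$, $|\cdot|$ is a norm on $\mathbb R^n$ with dual norm $|\cdot|^*$, and $L^1,L^\infty$ are the usual spaces of (equivalence classes of) $\mathbb R^n$-valued random variables, with $\|u\|_{L^\infty}:=|(\|u_1\|_{L^\infty},\dots,\|u_n\|_{L^\infty})|$. $E$ is expectation. Finitely additive measures. $\mathcal M^1$ is the set of bounded, $P$-absolutely continuous (i.e. vanishing on $P$-null sets), finitely additive $\mathbb R^n$-valued measures on $(\Omega,\mathcal F)$. For $m\in\mathcal M^1$, $|m|^*(A):=|m^+(A)+m^-(A)|^*$, where $m^\pm$ are the componentwise positive and negative parts. $\mathcal M^{1s}$ (the singular, or purely finitely additive, elements) is the set of $m\in\mathcal M^1$ for which there is a decreasing $(A^\nu)_{\nu=1}^\infty\subset\mathcal F$ with $P(A^\nu)\searrow0$ and $|m|^*(\Omega\setminus A^\nu)=0$ for all $\nu$. For $u\in L^\infty$, $\int_\Omega u\,dm$ is the unique norm-continuous linear extension of $\int_\Omega\sum_j\alpha^j1_{A^j}\,dm:=\sum_j\alpha^j\cdot m(A^j)$ from simple functions. Extended integral. For $m\in\mathcal M^1$ and $u\in L^1$ let $\rho_m(u):=\sup\{\int_\Omega u'\,dm\mid u'\in L^\infty,\ |u'_j|\le|u_j|\ \forall j=1,\dots,n\}$. This is a seminorm on $\operatorname{dom}\rho_m:=\{u\in L^1\mid\rho_m(u)<\infty\}$, $|\int_\Omega u\,dm|\le\rho_m(u)$ on $L^\infty$, and $L^\infty$ is $\rho_m$-dense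 in $\operatorname{dom}\rho_m$. For $u\in\operatorname{dom}\rho_m$, $\int_\Omega u\,dm$ denotes the unique $\rho_m$-continuous linear extension of the integral from $L^\infty$. Setting. A function $p:L^1\to\overline{\mathbb R}$ is sublinear if $p(0)=0$, $p(\alpha u)=\alpha p(u)$ for $\alpha>0$, and $p(u+v)\le p(u)+p(v)$; symmetric if $p(-u)=p(u)$; $\operatorname{dom}p:=\{u\mid p(u)<\infty\}$. Assumptions: (A1) the topology of $\mathcal U$ is no weaker than the relative $L^1$-norm topology; and for each $p\in\mathcal P$: (A2) there is a constant $c$ with $p(u)\le c\|u\|_{L^\infty}$ for all $u\in L^1$ (the right side being $+\infty$ if $u\notin L^\infty$); (A3) $p(u')\le p(u)$ for every $u\in\mathcal U$ and $u'\in L^1$ with $|u'|\le|u|$. Optional conditions on $p$: (A4) $p(u1_{A^\nu})\searrow0$ for all $u\in L^\infty$ and all decreasing $(A^\nu)_{\nu=1}^\infty\subset\mathcal F$ with $P(A^\nu)\searrow0$; (A5) $p(u1_{A^\nu})\searrow0$ for all $u\in\mathcal U$ and all decreasing $(A^\nu)_{\nu=1}^\infty\subset\mathcal F$ with $P(A^\nu)\searrow0$. Dual objects. For $m\in\mathcal M^1$, $p^\circ(m):=\sup\{\int_\Omega u\,dm\mid u\in L^\infty,\ p(u)\le1\}$. $\mathcal M$ is the set of $m\in\mathcal M^1$ with $p^\circ(m)<\infty$ for some $p\in\mathcal P$; $\mathcal M^s:=\mathcal M\cap\mathcal M^{1s}$; $\mathcal Y\subset L^1$ is the set of densities $y=dm/dP$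 of the countably additive $m\in\mathcal M$; $(L^\infty)^\perp:=\{w\in\mathcal U^*\mid\langle u,w\rangle=0\ \forall u\in L^\infty\}$.
   Formalization: Existence of the decomposition is proved only for directed P (any two p, q in P are bounded on U by a constant multiple of some r in P); without this it fails, e.g. for two atoms with P={|u(ω1)|,|u(ω2)|}, because M asks p°(m)<∞ for a single p in P. *)

(* Defs.v *)
From HB Require Import structures.
From mathcomp Require Import all_boot all_order all_algebra.
From mathcomp Require Import all_classical all_reals all_analysis.
Set Implicit Arguments.
Unset Strict Implicit.
Unset Printing Implicit Defensive.
Import Order.TTheory GRing.Theory Num.Theory.
Import numFieldNormedType.Exports.
Local Open Scope classical_set_scope.
Local Open Scope ring_scope.

(* A random vector is a function u : T -> 'rV[R]_n, with j-th coordinate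
   fun x => u x ord0 j.  The spaces L^1, L^oo, U, ... are sets of such functions
   that are closed under almost sure equality; functionals on classes of random
   vectors are functionals on representatives that respect it. *)

Section vector_norms.
Context {R : realType} {n : nat}.
Implicit Types (N : 'rV[R]_n -> R) (a b : 'rV[R]_n).

Definition dot a b : R := \sum_(j < n) a ord0 j * b ord0 j.

Definition is_norm N : Prop :=
  [/\ forall a, N a = 0 -> a = 0,
      forall (k : R) a, N (k *: a) = `|k| * N a
    & forall a b, N (a + b) <= N a + N b].

Definition dual_norm N b : R := sup [set dot a b | a in [set a | N a <= 1]].

End vector_norms.

Section generated_topology.
Context {R : realType} {V : lmodType R}.
Implicit Types (D : set V) (Q : set (V -> \bar R)) (f : V -> R).

(* Neighborhoods of u in the linear subspace D endowed with the coarsest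
   locally convex topology making the seminorms q in Q continuous. *)
Definition gen_nbhs D Q (u : V) : set_system V :=
  [set W | exists (F : set (V -> \bar R)) (e : R),
     [/\ finite_set F, F `<=` Q, 0 < e &
         [set v | D v /\ forall q, F q -> (q (v - u)%R < e%:E)%E] `<=` W]].

Definition gen_continuous D Q f : Prop :=
  forall u, D u -> f @ gen_nbhs D Q u --> f u.

Definition linear_on D f : Prop :=
  forall (k : R) u v, D u -> D v -> f (k *: u + v) = k * f u + f v.

End generated_topology.

Section random_vectors.
Context {d : measure_display} {T : measurableType d} {R : realType}.
Variables (P : probability T R) (n : nat) (N : 'rV[R]_n -> R).
Local Notation rvec := (T -> 'rV[R]_n).
Implicit Types (u v : rvec) (p : rvec -> \bar R) (PP : set (rvec -> \bar R)).
Implicit Types (A : nat -> set T) (m : set T -> 'rV[R]_n) (f : rvec -> R).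

Definition L1 : set rvec :=
  [set u | forall j, (fun x => u x ord0 j) \in Lfun P 1%E].

Definition Linf : set rvec :=
  [set u | forall j, (fun x => u x ord0 j) \in Lfun P +oo%E].

Definition L1_norm u : \bar R := ('E_P[N \o u])%E.

(* Meaningful for u in Linf, where every coordinate has a finite norm. *)
Definition Linf_norm u : R :=
  N (\row_j fine (Lnorm P +oo%E (fun x => (u x ord0 j)%:E))).

Definition restr u (B : set T) : rvec := fun x => \1_B x *: u x.

Definition decreases_to0 (a : nat -> \bar R) : Prop :=
  nonincreasing_seq a /\ a @ \oo --> 0%E.

Definition vanishing A : Prop :=
  [/\ forall k, measurable (A k),
      forall k, A k.+1 `<=` A k
    & decreases_to0 (fun k => P (A k))].

Definition sublinear_symmetric p : Prop :=
  [/\ forall u v, L1 u -> L1 v -> (\forall x \ae P, u x = v x) -> p u = p v,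
      p 0 = 0%E,
      forall (k : R) u, 0 < k -> L1 u -> p (k *: u) = (k%:E * p u)%E,
      forall u v, L1 u -> L1 v -> (p (u + v)%R <= p u + p v)%E
    & forall u, L1 u -> p (- u) = p u].

Definition dom p : set rvec := [set u | L1 u /\ (p u < +oo)%E].

Definition Uspace PP : set rvec :=
  [set u | L1 u /\ forall p, PP p -> dom p u].

(* The topology generated by PP is no weaker than the relative L^1-norm one. *)
Definition A1 PP : Prop := forall u, Uspace PP u ->
  gen_nbhs (Uspace PP) [set L1_norm] u `<=` gen_nbhs (Uspace PP) PP u.

(* Outside Linf the bound is +oo, so that there is nothing to require. *)
Definition A2 p : Prop :=
  exists c : R, forall u, Linf u -> (p u <= (c * Linf_norm u)%:E)%E.

Definition A3 PP p : Prop := forall u u', Uspace PP u -> L1 u' ->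
  (\forall x \ae P, N (u' x) <= N (u x)) -> (p u' <= p u)%E.

Definition A4 p : Prop := forall u A, Linf u -> vanishing A ->
  decreases_to0 (fun k => p (restr u (A k))).

Definition A5 PP p : Prop := forall u A, Uspace PP u -> vanishing A ->
  decreases_to0 (fun k => p (restr u (A k))).

(* Up to constants, any two elements of PP are dominated on U by a third one;
   equivalently the balls of the individual elements of PP form a neighborhood
   base of the origin in the topology generated by PP. *)
Definition directed PP : Prop := forall p q, PP p -> PP q ->
  exists r, PP r /\ exists c : R, forall u, Uspace PP u ->
    (p u <= c%:E * r u)%E /\ (q u <= c%:E * r u)%E.

Definition top_dual PP f : Prop :=
  linear_on (Uspace PP) f /\ gen_continuous (Uspace PP) PP f.

Definition annihilator PP f : Prop :=
  top_dual PP f /\ forall u, Linf u -> f u = 0.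

(* Only the values on measurable sets matter. *)
Definition M1 m : Prop :=
  [/\ forall j, additive2 (fun B => (m B ord0 j)%:E),
      exists C : R, forall B j, measurable B -> `|m B ord0 j| <= C
    & forall B, measurable B -> P B = 0%E -> m B = 0].

(* Componentwise Jordan decomposition. *)
Definition pos_part m (B : set T) : 'rV[R]_n :=
  \row_j sup [set m C ord0 j | C in [set C | measurable C /\ C `<=` B]].

Definition neg_part m : set T -> 'rV[R]_n := pos_part (fun B => - m B).

Definition abs_dual m (B : set T) : R :=
  dual_norm N (pos_part m B + neg_part m B).

Definition M1s m : Prop :=
  M1 m /\ exists A, vanishing A /\ forall k, abs_dual m (~` A k) = 0.

Definition countably_additive m : Prop :=
  forall j, semi_sigma_additive (fun B => (m B ord0 j)%:E).

(* The norm-continuous linear extension to Linf of the integral of simple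
   functions; its values outside Linf are irrelevant. *)
Definition is_integral m f : Prop :=
  [/\ linear_on Linf f,
      gen_continuous Linf [set (EFin \o Linf_norm : rvec -> \bar R)] f
    & forall k (a : 'I_k -> 'rV[R]_n) (B : 'I_k -> set T),
        (forall j, measurable (B j)) ->
        f (fun x => \sum_(j < k) \1_(B j) x *: a j)
        = \sum_(j < k) dot (a j) (m (B j))].

Definition Linf_integral m : rvec -> R := xget (fun=> 0) (is_integral m).

Definition rho m u : \bar R :=
  ereal_sup [set (Linf_integral m u')%:E | u' in [set u' | Linf u' /\
    forall j, \forall x \ae P, `|u' x ord0 j| <= `|u x ord0 j|]].

(* The rho-continuous linear extension of the integral from Linf to dom rho;
   its values outside dom rho are irrelevant. *)
Definition is_extended_integral m f : Prop :=
  [/\ linear_on (dom (rho m)) f,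
      gen_continuous (dom (rho m)) [set rho m] f
    & forall u, Linf u -> f u = Linf_integral m u].

Definition integral_fa m : rvec -> R :=
  xget (fun=> 0) (is_extended_integral m).

Definition polar p m : \bar R :=
  ereal_sup [set (Linf_integral m u)%:E
            | u in [set u | Linf u /\ (p u <= 1)%E]].

Definition Mspace PP m : Prop :=
  M1 m /\ exists p, PP p /\ (polar p m < +oo)%E.

Definition Ms PP m : Prop := Mspace PP m /\ M1s m.

Definition density m (y : rvec) : Prop := L1 y /\
  forall B j, measurable B ->
    (m B ord0 j)%:E = (\int[P]_(x in B) (y x ord0 j)%:E)%E.

Definition Yspace PP (y : rvec) : Prop :=
  exists m, [/\ Mspace PP m, countably_additive m & density m y].

(* <u, f> = E[u . y] + int u dm + <u, w> for all u in U.  The identity is in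
   \bar R, so that it also asserts that E[u . y] is finite. *)
Definition represents PP (y : rvec) m (w f : rvec -> R) : Prop :=
  forall u, Uspace PP u ->
    ((f u)%:E = 'E_P[fun x => dot (u x) (y x)] + (integral_fa m u)%:E
                + (w u)%:E)%E.

End random_vectors.

(* Main.v *)
(* A continuous [f] on U is dominated by a multiple of some [p] in PP, so that
   B |-> (f (1_B e_j))_j is a finitely additive measure [m] in M whose integral is
   [f] on L^oo.  Among the sequences of sets of vanishing probability choose one,
   [A], carrying the largest limiting mass of the variation of [m].  Then
   B |-> lim m (B \ A_k) is absolutely continuous in the epsilon-delta sense, hence
   countably additive with a density [y], and the rest of [m] vanishes off each
   A_k.  Both parts stay in M because [p] is monotone by (A3), and what [f] adds to
   their integrals on U vanishes on L^oo.

   The integral of u in U against m in M is controlled by p(u) since [u] differs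
   from the bounded u 1_{|u| <= k} by u 1_{|u| > k}, on which rho_m is small: a
   bounded v satisfies v 1_{|u| > k} <= (C / k) |u|, so (A3) bounds p there by a
   multiple of p(u) / k. *)

Require Import Defs.
From HB Require Import structures.
From mathcomp Require Import all_boot all_order all_algebra.
From mathcomp Require Import all_classical all_reals all_analysis.
From mathcomp Require Import measurable_realfun ess_sup_inf.
From mathcomp Require Import ring lra.
Set Implicit Arguments.
Unset Strict Implicit.
Unset Printing Implicit Defensive.
Import Order.TTheory GRing.Theory Num.Theory.
Import numFieldNormedType.Exports.
Local Open Scope classical_set_scope.
Local Open Scope ring_scope.

(** * Norms on R^n *)

Section sum_norm.
Context {R : realType} {n : nat}.
Implicit Types a b : 'rV[R]_n.

(** Order intervals such as the one in [rho] are described by coordinates, whereas [N] need not be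
    monotone in them. Estimates are therefore made with the l1 norm of the coordinates, and
    [norm_equiv] returns to [N] at the price of a constant. The sharp inequality with the polar
    cannot afford a constant; it is reached by restricting [u] to a set, an operation that (A3)
    handles exactly.

    Membership in M asks for a single element of PP, while a continuous functional is controlled by
    finitely many. [directed] merges them, and both parts of the measure are then bounded by the
    same element.

    The countably additive part enters the formula through an expectation, whose finiteness on U is
    a claim of its own: the polar bounds the pairing of [y] with truncated coordinates of [u]
    uniformly in the level, and monotone convergence passes to the limit.

    Uniqueness is decided on indicators: there [w] vanishes, and outside the two carriers only the
    densities are left. Since the carriers shrink to a null set, the densities agree almost
    surely. *)

Definition l1norm a : R := \sum_(j < n) `|a ord0 j|.

Lemma l1norm_ge0 a : 0 <= l1norm a.
Proof. exact: sumr_ge0. Qed.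

Lemma l1normD a b : l1norm (a + b) <= l1norm a + l1norm b.
Proof.
rewrite -big_split; apply: ler_sum => j _ /=; rewrite mxE; exact: ler_normD.
Qed.

Lemma l1normZ k a : l1norm (k *: a) = `|k| * l1norm a.
Proof. by rewrite mulr_sumr; apply: eq_bigr => j _; rewrite mxE normrM. Qed.

Lemma l1norm0 : l1norm 0 = 0.
Proof. by rewrite -(scale0r 0) l1normZ normr0 mul0r. Qed.

Lemma coord_le_l1norm a j : `|a ord0 j| <= l1norm a.
Proof. by rewrite /l1norm (bigD1 j) //= lerDl sumr_ge0. Qed.

Lemma le_l1norm a b : (forall j, `|a ord0 j| <= `|b ord0 j|) -> l1norm a <= l1norm b.
Proof. by move=> ab; apply: ler_sum. Qed.

Lemma dot_le a b M : (forall j, `|b ord0 j| <= M) -> `|dot a b| <= l1norm a * M.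
Proof.
move=> bM; rewrite /dot mulr_suml; apply: le_trans (ler_norm_sum _ _ _) _.
by apply: ler_sum => j _; rewrite normrM ler_wpM2l.
Qed.

Lemma dotDl a b c : dot (a + b) c = dot a c + dot b c.
Proof. by rewrite -big_split; apply: eq_bigr => j _; rewrite mxE mulrDl. Qed.

Lemma dotDr a b c : dot a (b + c) = dot a b + dot a c.
Proof. by rewrite -big_split; apply: eq_bigr => j _; rewrite mxE mulrDr. Qed.

Lemma dotZl k a b : dot (k *: a) b = k * dot a b.
Proof. by rewrite mulr_sumr; apply: eq_bigr => j _; rewrite mxE mulrA. Qed.

Lemma dotZr k a b : dot a (k *: b) = k * dot a b.
Proof. by rewrite mulr_sumr; apply: eq_bigr => j _; rewrite mxE mulrCA. Qed.

Lemma dot_deltal j b : dot (delta_mx ord0 j) b = b ord0 j.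
Proof.
rewrite /dot (bigD1 j) //= mxE !eqxx mul1r big1 ?addr0 // => i ij.
by rewrite mxE eqxx (negbTE ij) mul0r.
Qed.

Lemma dot0r a : dot a 0 = 0.
Proof. by rewrite -(scale0r 0) dotZr mul0r. Qed.

Lemma dot0l a : dot 0 a = 0.
Proof. by rewrite -(scale0r 0) dotZl mul0r. Qed.

Lemma l1norm_delta k (j : 'I_n) : l1norm (k *: delta_mx ord0 j) = `|k|.
Proof.
rewrite /l1norm (bigD1 j) //= !mxE !eqxx mulr1 big1 ?addr0 // => i ij.
by rewrite !mxE eqxx (negbTE ij) mulr0 normr0.
Qed.

Variable N : 'rV[R]_n -> R.
Hypothesis Nnorm : is_norm N.

Lemma norm_0 : N 0 = 0.
Proof. by case: Nnorm => _ NZ _; rewrite -(scale0r 0) NZ normr0 mul0r. Qed.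

Lemma norm_opp a : N (- a) = N a.
Proof. by case: Nnorm => _ NZ _; rewrite -scaleN1r NZ normrN1 mul1r. Qed.

Lemma norm_ge0 a : 0 <= N a.
Proof.
case: Nnorm => _ _ ND.
have := ND a (- a); rewrite subrr norm_0 norm_opp => h; lra.
Qed.

Lemma norm_le_l1norm : exists2 C, 0 < C & forall a, N a <= C * l1norm a.
Proof.
case: Nnorm => _ NZ ND.
have NS (s : seq 'I_n) (F : 'I_n -> 'rV[R]_n) :
    N (\sum_(i <- s) F i) <= \sum_(i <- s) N (F i).
  elim: s => [|i s IH]; first by rewrite !big_nil norm_0.
  by rewrite !big_cons; apply: le_trans (ND _ _) _; rewrite lerD2l.
(* The summand 1 makes the constant positive even for an empty sum. *)
exists (1 + \sum_(j < n) N (delta_mx ord0 j)).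
  by rewrite ltr_pwDl // sumr_ge0 // => j _; exact: norm_ge0.
move=> a; rewrite {1}(row_sum_delta a); apply: le_trans (NS _ _) _.
rewrite /l1norm mulr_sumr; apply: ler_sum => j _; rewrite NZ mulrC ler_wpM2r //.
rewrite (bigD1 j) //=.
have : 0 <= \sum_(i < n | i != j) N (delta_mx ord0 i).
  by rewrite sumr_ge0 // => i _; exact: norm_ge0.
lra.
Qed.

(** [N] is Lipschitz for the matrix norm, so it attains a minimum on the compact unit sphere,
    positive by definiteness; homogeneity does the rest. The sphere is empty for [n = 0], which is
    treated apart. *)
Lemma l1norm_le_norm : exists2 C, 0 < C & forall a, l1norm a <= C * N a.
Proof.
case: (Nnorm) => N0 NZ ND; have [C C0 NC] := norm_le_l1norm.
have [n0|n0] := posnP n.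
  exists 1 => // a; rewrite /l1norm big1 ?mul1r ?norm_ge0 // => j.
  by have := ltn_ord j; rewrite {2}n0.
have nR : 0 < n%:R :> R by rewrite ltr0n.
have l1_le a : l1norm a <= n%:R * `|a|.
  rewrite -[n in n%:R]card_ord mulr_natl -sumr_const; apply: ler_sum => j _.
  rewrite [leRHS]/Num.norm /= mx_normrE.
  by apply/bigmax_geP; right => /=; exists (ord0, j).
have le_l1 a : `|a| <= l1norm a.
  rewrite [leLHS]/Num.norm /= mx_normrE; apply: bigmax_le; first exact: l1norm_ge0.
  by move=> [i j] _ /=; rewrite (ord1 i) coord_le_l1norm.
have Nlip a b : `|N a - N b| <= (C * n%:R) * `|a - b|.
  apply: (@le_trans _ _ (N (a - b))); last first.
    by apply: le_trans (NC _) _; rewrite -mulrA ler_wpM2l // ltW.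
  have := ND (a - b) b; rewrite subrK => h1.
  have := ND (b - a) a; rewrite subrK -opprB norm_opp => h2.
  by rewrite ler_norml; lra.
have lipc (F : 'rV[R]_n -> R) c : 0 < c ->
    (forall a b, `|F a - F b| <= c * `|a - b|) -> continuous F.
  move=> c0 Flip a; apply/(@cvgrPdist_le _ _ _ _ (nbhs_filter a)) => e e0.
  apply/nbhs_ballP; exists (e / c); first by rewrite /= divr_gt0.
  move=> b; rewrite mx_norm_ball /= => ab; apply: le_trans (Flip _ _) _.
  by rewrite mulrC -ler_pdivlMr // ltW.
have cN : continuous N by apply: lipc Nlip; rewrite mulr_gt0.
have cnorm : continuous (fun a : 'rV[R]_n => `|a|).
  by apply: (lipc _ 1) => // a b; rewrite mul1r ler_dist_dist.
pose S := [set a : 'rV[R]_n | `|a| = 1].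
have cS : compact S.
  apply: bounded_closed_compact.
    exists 1; split=> // M M1 a; rewrite /S /= => ->; exact: ltW.
  apply: (@preimage_closed _ _ (fun a : 'rV[R]_n => `|a|) [set 1]).
    by move=> x _; exact: cnorm.
  exact: closed_eq.
have S0 : S !=set0.
  pose v := delta_mx ord0 (Ordinal n0) : 'rV[R]_n.
  have v0 : v != 0.
    apply/eqP => /matrixP /(_ ord0 (Ordinal n0)); rewrite !mxE !eqxx /= => /eqP.
    by rewrite oner_eq0.
  exists (`|v|^-1 *: v); rewrite /S /= normrZ normfV normr_id mulVf //.
  by rewrite normr_eq0.
have [c Sc cmin] := EVT_min_rV S0 cS (continuous_subspaceT cN).
have Nc : 0 < N c.
  rewrite lt_neqAle norm_ge0 andbT eq_sym; apply/eqP => /N0 c0.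
  by move: Sc; rewrite inE /S /= c0 normr0 => /esym/eqP; rewrite oner_eq0.
exists (n%:R / N c); first by rewrite divr_gt0.
move=> a; have [->|a0] := eqVneq a 0; first by rewrite l1norm0 norm_0 mulr0.
apply: le_trans (l1_le a) _; rewrite -mulrA; apply: ler_wpM2l; first exact: ltW.
have na : 0 < `|a| by rewrite normr_gt0.
have := cmin (`|a|^-1 *: a); rewrite inE /S /= normrZ normfV normr_id mulVf ?gt_eqF //.
move=> /(_ erefl); rewrite NZ normfV normr_id => h.
rewrite ler_pdivlMl //; have := ler_wpM2l (ltW na) h.
by rewrite mulrA divff ?gt_eqF // mul1r mulrC.
Qed.

Lemma norm_equiv : exists2 C, 0 < C &
  forall a, N a <= C * l1norm a /\ l1norm a <= C * N a.
Proof.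
have [C C0 h] := norm_le_l1norm; have [C' C'0 h'] := l1norm_le_norm.
exists (C + C'); first by rewrite addr_gt0.
move=> a; have := h a; have := h' a; have := l1norm_ge0 a; have := norm_ge0 a.
move=> a0 b0 A B; split; nra.
Qed.

End sum_norm.

(** * Linear functionals and extension by density *)

Lemma eq0_le_eps {R : realType} (x K : R) :
  (forall e, 0 < e -> `|x| <= K * e) -> x = 0.
Proof.
move=> h; apply/eqP; rewrite -normr_le0 leNgt; apply/negP => x0.
have K0 : 0 < K.
  rewrite ltNge; apply/negP => K0.
  by have := h 1 ltr01; rewrite mulr1 => h1; lra.
have := h (`|x| / (K * 2)); rewrite divr_gt0 ?mulr_gt0 // => /(_ isT).
rewrite (_ : K * _ = `|x| / 2); last by field; rewrite gt_eqF.
by move: x0; lra.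
Qed.

(** Turns continuity at 0 into a bound, with [x] the value of a linear functional and [r] a
    seminorm. For [r > 0] the strict inequality [t * r < a] is met by [t = a / (2 * r)], whence the
    factor 2; for [r = 0] every [t] is allowed and [x] must vanish. *)
Lemma scaling_bound {R : realType} (x r a : R) : 0 <= r -> 0 < a ->
  (forall t, 0 < t -> t * r < a -> t * `|x| < 1) -> `|x| <= 2 / a * r.
Proof.
move=> r0 a0 h; move: r0; rewrite le_eqVlt => /predU1P[r0|r0].
  rewrite -r0 mulr0 leNgt; apply/negP => x0.
  have := h `|x|^-1; rewrite invr_gt0 x0 -r0 mulr0 a0 mulVf ?gt_eqF // ltxx.
  by move=> /(_ isT isT).
have t0 : 0 < a / (2 * r) by rewrite divr_gt0 // mulr_gt0.
have := h _ t0; rewrite (_ : a / (2 * r) * r = a / 2); last by field; rewrite gt_eqF.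
have -> : a / 2 < a by lra.
move=> /(_ isT) /ltW; rewrite -ler_pdivlMl // mulr1 invf_div => /le_trans; apply.
by rewrite mulrAC.
Qed.

Section dense_extension.
Context {R : realType} {V : lmodType R}.
(** [G u r] is the graph of a functional on the dense subspace, and [B u K] says that [K] bounds the
    seminorm of [u]. Relations admit functionals given through non-unique representations, whose
    consistency is part of [GB], and seminorms that may be infinite. *)
Variables (G : V -> R -> Prop) (B : V -> R -> Prop) (M : R).
Hypothesis Glin : forall k u r v s, G u r -> G v s -> G (k *: u + v) (k * r + s).
Hypothesis Blin : forall k u K v L,
  B u K -> B v L -> B (k *: u + v) (`|k| * K + L).
Hypothesis GB : forall u r K, G u r -> B u K -> `|r| <= M * K.

(* Each approximation [(v, r)] of [u] with error [K] confines the value at [u] to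
   [r - M K, r + M K]; these intervals intersect pairwise, so that the supremum of
   their left ends lies in all of them and no limit is needed. *)
Lemma dense_extension (D : set V) :
  (forall u, D u -> forall e, 0 < e -> exists v r, G v r /\ B (u - v) e) ->
  exists f, linear_on D f /\
    forall u v r K, G v r -> B (u - v) K -> `|f u - r| <= M * K.
Proof.
move=> dense.
pose S u := [set x | exists v r K, [/\ G v r, B (u - v) K & x = r - M * K]].
have Sub u v r K v' r' K' : G v r -> B (u - v) K -> G v' r' -> B (u - v') K' ->
    r - M * K <= r' + M * K'.
  move=> Gv Bv Gv' Bv'.
  have Gd := Glin (-1) Gv' Gv; have Bd := Blin (-1) Bv Bv'.
  have E : -1 *: v' + v = -1 *: (u - v) + (u - v').
    by rewrite !scaleN1r opprB addrA subrK addrC.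
  rewrite -E in Bd; have := GB Gd Bd.
  rewrite normrN1 mul1r mulN1r mulrDr ler_norml => /andP[]; lra.
exists (fun u => sup (S u)).
have main u v r K : G v r -> B (u - v) K -> `|sup (S u) - r| <= M * K.
  move=> Gv Bv.
  have hub : has_ubound (S u).
    by exists (r + M * K) => _ [v' [r' [K' [Gv' Bv' ->]]]]; exact: Sub Gv' Bv' Gv Bv.
  have Sr : S u (r - M * K) by exists v, r, K.
  have h1 : r - M * K <= sup (S u) by exact: ub_le_sup.
  have h2 : sup (S u) <= r + M * K.
    apply: ge_sup; first by exists (r - M * K).
    by move=> _ [v' [r' [K' [Gv' Bv' ->]]]]; exact: Sub Gv' Bv' Gv Bv.
  by rewrite ler_norml; lra.
have eps u e : D u -> 0 < e -> exists v r, [/\ G v r, B (u - v) e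
    & `|sup (S u) - r| <= M * e].
  move=> Du e0; have [v [r [Gv Bv]]] := dense _ Du _ e0.
  by exists v, r; split=> //; exact: main Gv Bv.
split; last exact: main.
move=> k u v Du Dv.
apply/eqP; rewrite -subr_eq0; apply/eqP.
apply: (@eq0_le_eps _ _ (M * (2 * (`|k| + 1)))) => e e0.
have [a [r [Ga Ba Ia]]] := eps _ _ Du e0.
have [b [s [Gb Bb Ib]]] := eps _ _ Dv e0.
have Gab := Glin k Ga Gb.
have Bab : B ((k *: u + v) - (k *: a + b)) (`|k| * e + e).
  by rewrite opprD addrACA -scalerBr; exact: Blin.
have := main _ _ _ _ Gab Bab.
have : `|k * (sup (S u) - r)| <= `|k| * (M * e) by rewrite normrM ler_wpM2l.
move: Ib; rewrite !ler_norml; lra.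
Qed.

End dense_extension.

Section generated_topology.
Context {R : realType} {V : lmodType R}.
Implicit Types (D : set V) (Q : set (V -> \bar R)) (f : V -> R).

Definition lin_closed D := D 0 /\ forall k u v, D u -> D v -> D (k *: u + v).

Lemma lin_closedB D u v : lin_closed D -> D u -> D v -> D (u - v).
Proof.
by move=> [_ h] Du Dv; rewrite addrC -scaleN1r; exact: h.
Qed.

Lemma lin_closedD D u v : lin_closed D -> D u -> D v -> D (u + v).
Proof. by move=> [_ h] Du Dv; rewrite -[u]scale1r; exact: h. Qed.

Lemma lin_closedZ D k u : lin_closed D -> D u -> D (k *: u).
Proof. by move=> [D0 h] Du; rewrite -[_ *: _]addr0; exact: h. Qed.

Lemma lin_closedN D u : lin_closed D -> D u -> D (- u).
Proof. by move=> DL Du; rewrite -scaleN1r; exact: lin_closedZ. Qed.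

Lemma linear_on0 D f : lin_closed D -> linear_on D f -> f 0 = 0.
Proof.
move=> [D0 _] fl; have := fl (-1) 0 0 D0 D0.
by rewrite scaler0 addr0 mulN1r addNr.
Qed.

Lemma linear_onZ D f k u : lin_closed D -> linear_on D f -> D u ->
  f (k *: u) = k * f u.
Proof.
move=> DL fl Du; rewrite -[k *: u]addr0 fl //; last by case: DL.
by rewrite (linear_on0 DL fl) addr0.
Qed.

Lemma linear_onD D f u v : lin_closed D -> linear_on D f -> D u -> D v ->
  f (u + v) = f u + f v.
Proof. by move=> DL fl Du Dv; rewrite -[u]scale1r fl // mul1r scale1r. Qed.

Lemma linear_onN D f u : lin_closed D -> linear_on D f -> D u -> f (- u) = - f u.
Proof. by move=> DL fl Du; rewrite -scaleN1r (linear_onZ _ DL) // mulN1r. Qed.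

Lemma linear_onB D f u v : lin_closed D -> linear_on D f -> D u -> D v ->
  f (u - v) = f u - f v.
Proof.
move=> DL fl Du Dv; rewrite (linear_onD DL fl) ?(linear_onN DL fl) //.
exact: lin_closedN.
Qed.

Lemma linear_on_sum D f (I : Type) (s : seq I) (F : I -> V) :
  lin_closed D -> linear_on D f -> (forall i, D (F i)) ->
  D (\sum_(i <- s) F i) /\ f (\sum_(i <- s) F i) = \sum_(i <- s) f (F i).
Proof.
move=> DL fl DF; elim: s => [|i s [IH1 IH2]].
  by rewrite !big_nil (linear_on0 DL fl); case: DL.
rewrite !big_cons; split; first exact: lin_closedD.
by rewrite (linear_onD DL fl) // IH2.
Qed.

Lemma gen_continuous_at0 D Q f : lin_closed D -> linear_on D f ->
  gen_continuous D Q f ->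
  exists (F : set (V -> \bar R)) (e : R), [/\ finite_set F, F `<=` Q, 0 < e &
    forall v, D v -> (forall q, F q -> (q v < e%:E)%E) -> `|f v| < 1].
Proof.
move=> DL fl fc; have D0 : D 0 by case: DL.
have := fc 0 D0 [set x | `|x| < 1].
rewrite (linear_on0 DL fl) => /(_ _)[].
  by apply/nbhs_ballP; exists 1 => //= x; rewrite /ball /= sub0r normrN.
move=> F [e [Ff FQ e0 h]]; exists F, e; split=> // v Dv hv.
by apply: h; split=> // q Fq; rewrite subr0; exact: hv.
Qed.

Lemma le_gen_continuous D Q f (q : V -> \bar R) C : lin_closed D ->
  linear_on D f -> Q q ->
  (forall v K, D v -> (q v <= K%:E)%E -> `|f v| <= C * K) ->
  gen_continuous D Q f.
Proof.
move=> DL fl Qq h u Du W /nbhs_ballP[e /= e0 eW].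
exists [set q], (e / (`|C| + 1)).
split; first exact: finite_set1.
- by move=> _ ->.
- by rewrite divr_gt0 // ltr_pwDr.
move=> v [Dv /(_ q erefl) /ltW qv] /=; apply: eW => /=.
have C1 : 0 < `|C| + 1 by rewrite ltr_pwDr.
have := h _ _ (lin_closedB DL Dv Du) qv; rewrite (linear_onB DL fl) // => h1.
rewrite /ball /= distrC; apply: le_lt_trans h1 _.
rewrite mulrA ltr_pdivrMr //; have := ler_norm C; nra.
Qed.

Lemma gen_continuous_comb D Q f g k : gen_continuous D Q f ->
  gen_continuous D Q g -> gen_continuous D Q (fun u => k * f u + g u).
Proof.
move=> fc gc u Du W /nbhs_ballP[e /= e0 eW].
pose c := `|k| + 1; have c0 : 0 < c by rewrite ltr_pwDr.
have ec : 0 < e / 2 / c by rewrite !divr_gt0.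
have e2 : 0 < e / 2 by rewrite divr_gt0.
have [F [a [Ff FQ a0 Fa]]] := fc u Du _ (nbhsx_ballx (f u) _ ec).
have [F' [b [Ff' FQ' b0 Fb]]] := gc u Du _ (nbhsx_ballx (g u) _ e2).
exists (F `|` F'), (Num.min a b); split.
- by rewrite finite_setU.
- by move=> q [/FQ|/FQ'].
- by rewrite lt_min a0 b0.
move=> v [Dv hv]; apply: eW => /=.
have /Fa /= : D v /\ (forall q, F q -> (q (v - u)%R < a%:E)%E).
  split=> // q Fq; apply: lt_le_trans (hv q (or_introl Fq)) _.
  by rewrite lee_fin ge_min lexx.
have /Fb /= : D v /\ (forall q, F' q -> (q (v - u)%R < b%:E)%E).
  split=> // q Fq; apply: lt_le_trans (hv q (or_intror Fq)) _.
  by rewrite lee_fin ge_min lexx orbT.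
rewrite /ball /= => h1 h2.
have h3 : `|k * (f u - f v)| <= c * (e / 2 / c).
  by rewrite normrM ler_pM // ?lerDl // ltW.
rewrite (mulrC c) divfK ?gt_eqF // in h3.
move: h1 h3; rewrite !ltr_norml !ler_norml; lra.
Qed.

End generated_topology.

(** * Random vectors *)

Section random_vectors.
Context {d : measure_display} {T : measurableType d} {R : realType}.
Variables (P : probability T R) (n : nat).
Local Notation rvec := (T -> 'rV[R]_n).
Implicit Types (u v : rvec).

Definition meas_rv u := forall j, measurable_fun [set: T] (fun x => u x ord0 j).

(** A relation instead of an essential supremum: it makes sense for every [u], is stable under
    linear combinations, and serves as the relation [B] of [dense_extension]. *)
Definition ae_le u (K : R) := \forall x \ae P, l1norm (u x) <= K.

Lemma meas_rv_lin : lin_closed meas_rv.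
Proof.
split=> [j|k u v mu mv j].
  by rewrite (_ : (fun=> _) = cst 0) //; apply/funext => x; rewrite mxE.
rewrite (_ : (fun=> _) = (fun x => k * u x ord0 j + v x ord0 j)).
  by apply: measurable_funD => //; exact: measurable_funM.
by apply/funext => x; rewrite !mxE.
Qed.

Lemma ae_le_lin k u K v L : ae_le u K -> ae_le v L ->
  ae_le (k *: u + v) (`|k| * K + L).
Proof.
move=> uK vL; near=> x; apply: le_trans (l1normD _ _) _.
rewrite l1normZ; apply: lerD; last by near: x.
by rewrite ler_wpM2l //; near: x.
Unshelve. all: by end_near. Qed.

Lemma ae_leW u K L : K <= L -> ae_le u K -> ae_le u L.
Proof. by move=> KL; apply: filterS => x /le_trans; exact. Qed.

Lemma ae_exists (Q : T -> Prop) : (\forall x \ae P, Q x) -> exists x, Q x.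
Proof.
move=> [A [mA PA QA]]; apply: contrapT => /forallNP nQ.
have AT : A = setT by apply/seteqP; split=> // x _; exact: QA (nQ x).
by move: PA; rewrite AT probability_setT => /eqP; rewrite onee_eq0.
Qed.

Lemma ae_le_ge0 u K : ae_le u K -> 0 <= K.
Proof. by move=> /ae_exists[x]; apply: le_trans; exact: l1norm_ge0. Qed.

Lemma ae_forall_ord (Q : 'I_n -> T -> Prop) :
  (forall j, \forall x \ae P, Q j x) -> \forall x \ae P, forall j, Q j x.
Proof. by move=> h; apply: filter_forall. Qed.

Lemma LinfP u : Linf P u <-> meas_rv u /\ exists K, ae_le u K.
Proof.
have PT : (0 < P setT)%E by rewrite probability_setT lte01.
split=> [uL|[mu [K uK]] j].
  have mu j : measurable_fun [set: T] (fun x => u x ord0 j).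
    by have := uL j; rewrite !inE => /andP[]; rewrite inE.
  split=> //.
  have /choice[M hM] : forall j, exists M, \forall x \ae P, `|u x ord0 j| <= M.
    move=> j.
    have := uL j; rewrite !inE => /andP[_]; rewrite inE /= /finite_norm.
    rewrite unlock /Lnorm PT => /ess_supr_bounded[M hM].
    by exists M.
  exists (\sum_(j < n) M j); have := ae_forall_ord hM; apply: filterS => x hx.
  by apply: ler_sum => j _; exact: hx.
rewrite !inE; apply/andP; split; rewrite inE //= /finite_norm.
rewrite unlock /Lnorm PT; apply: (@le_lt_trans _ _ K%:E); last exact: ltry.
apply/ess_supP; apply: filterS uK => x /= h; rewrite lee_fin.
exact: le_trans (coord_le_l1norm _ _) h.
Qed.

Lemma Linf_lin : lin_closed (@Linf _ T R P n).
Proof.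
split=> [|k u v /LinfP[mu [K uK]] /LinfP[mv [L vL]]]; apply/LinfP.
  split; first by case: meas_rv_lin.
  by exists 0; apply: nearW => x; rewrite l1norm0.
split; first by case: meas_rv_lin => _; exact.
by exists (`|k| * K + L); exact: ae_le_lin.
Qed.

Lemma L1P u : L1 P u <-> forall j, P.-integrable setT (fun x => (u x ord0 j)%:E).
Proof. by split=> h j; apply/Lfun1_integrable; exact: h. Qed.

Lemma L1_meas u : L1 P u -> meas_rv u.
Proof.
by move=> /L1P uL j; have /measurable_int/measurable_EFinP := uL j.
Qed.

Lemma Linf_meas u : Linf P u -> meas_rv u.
Proof. by case/LinfP. Qed.

Lemma L1_lin : lin_closed (@L1 _ T R P n).
Proof.
split=> [|k u v /L1P uL /L1P vL]; apply/L1P => j.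
  rewrite (_ : (fun=> _) = cst 0%E); first exact: integrable0.
  by apply/funext => x; rewrite mxE.
rewrite (_ : (fun=> _) =
  (fun x => k%:E * (u x ord0 j)%:E) \+ (fun x => (v x ord0 j)%:E))%E.
  by apply: integrableD => //; exact: integrableZl.
by apply/funext => x; rewrite !mxE EFinD EFinM.
Qed.

Lemma L1_le u (g : T -> R) : P.-integrable setT (EFin \o g) -> meas_rv u ->
  (\forall x \ae P, l1norm (u x) <= g x) -> L1 P u.
Proof.
move=> ig mu ug; apply/L1P => j; apply/integrableP; split.
  exact/measurable_EFinP.
have [mg gfin] := integrableP _ _ _ ig.
apply: le_lt_trans gfin.
apply: ae_ge0_le_integral => //.
- by apply: measurableT_comp => //; exact/measurable_EFinP.
- exact: measurableT_comp.
- apply: filterS ug => x h _; rewrite lee_fin.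
  exact: le_trans (coord_le_l1norm _ _) (le_trans h (ler_norm _)).
Qed.

Lemma Linf_L1 u : Linf P u -> L1 P u.
Proof.
move=> /LinfP[mu [K uK]]; apply: (@L1_le _ (cst K)) => //.
exact: finite_measure_integrable_cst.
Qed.

Lemma L1_l1norm u : L1 P u -> P.-integrable setT (fun x => (l1norm (u x))%:E).
Proof.
move=> /L1P uL.
rewrite (_ : (fun=> _) = (fun x => \sum_(i < n) `|(u x ord0 i)%:E|)%E).
  by apply: integrable_sum => // i _; exact: integrable_abse.
by apply/funext => x; rewrite sumEFin.
Qed.

Lemma L1_dom u v C : L1 P v -> meas_rv u ->
  (\forall x \ae P, l1norm (u x) <= C * l1norm (v x)) -> L1 P u.
Proof.
move=> vL mu uv; apply: (@L1_le _ (fun x => C * l1norm (v x))) => //.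
exact: (integrableZl measurableT _ (L1_l1norm vL)).
Qed.

Lemma meas_restr u B : measurable B -> meas_rv u -> meas_rv (restr u B).
Proof.
move=> mB mu j; rewrite (_ : (fun=> _) = (fun x => \1_B x * u x ord0 j)).
  by apply: measurable_funM => //; exact: measurable_indic.
by apply/funext => x; rewrite /restr mxE.
Qed.

Lemma restr_in u (B : set T) x : B x -> restr u B x = u x.
Proof. by move=> Bx; rewrite /restr indicE mem_set // scale1r. Qed.

Lemma restr_out u (B : set T) x : ~ B x -> restr u B x = 0.
Proof. by move=> Bx; rewrite /restr indicE memNset // scale0r. Qed.

Lemma restrC u (B : set T) : u = restr u B + restr u (~` B).
Proof.
apply/funext => x /=; have [Bx|Bx] := pselect (B x).
  by rewrite fctE restr_in // restr_out ?addr0 // => /(_ Bx).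
by rewrite fctE restr_out // restr_in // add0r.
Qed.

Lemma restr_lin k u v (B : set T) : restr (k *: u + v) B = k *: restr u B + restr v B.
Proof. by apply/funext => x; rewrite /restr !fctE scalerDr !scalerA mulrC. Qed.

Lemma l1norm_restr u (B : set T) x : l1norm (restr u B x) <= l1norm (u x).
Proof.
have [Bx|Bx] := pselect (B x); first by rewrite restr_in.
by rewrite restr_out // l1norm0 l1norm_ge0.
Qed.

Lemma ae_le_restr u B K : ae_le u K -> ae_le (restr u B) K.
Proof. by apply: filterS => x; apply: le_trans; exact: l1norm_restr. Qed.

Lemma Linf_restr u B : measurable B -> Linf P u -> Linf P (restr u B).
Proof.
move=> mB /LinfP[mu [K uK]]; apply/LinfP; split; first exact: meas_restr.
by exists K; exact: ae_le_restr.
Qed.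

Lemma meas_l1norm u : meas_rv u -> measurable_fun [set: T] (fun x => l1norm (u x)).
Proof.
move=> mu; rewrite /l1norm; apply: measurable_sum => j.
by apply: measurableT_comp => //; exact: mu.
Qed.

Lemma meas_l1norm_gt u K : meas_rv u -> measurable [set x | K < l1norm (u x)].
Proof.
move=> mu; rewrite -[X in measurable X]setTI.
exact: (measurable_fun_ltr (measurable_cst K) (meas_l1norm mu)).
Qed.

Lemma Linf_trunc u K : meas_rv u -> Linf P (restr u (~` [set x | K < l1norm (u x)])).
Proof.
move=> mu; apply/LinfP; split.
  by apply: meas_restr => //; apply: measurableC; exact: meas_l1norm_gt.
(* For negative [K] nothing is kept and the truncation is 0, hence the maximum. *)
exists (Num.max 0 K); apply: nearW => x.
have [h|h] := ltP K (l1norm (u x)).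
  by rewrite restr_out ?l1norm0 ?le_max ?lexx //= => /(_ h).
by rewrite restr_in ?le_max ?h ?orbT //= ltNge h.
Qed.

Lemma vanishing_gt u : meas_rv u -> vanishing P (fun k => [set x | k%:R < l1norm (u x)]).
Proof.
move=> mu; have mA k : measurable [set x | k%:R < l1norm (u x)] by exact: meas_l1norm_gt.
have sA k : [set x | k.+1%:R < l1norm (u x)] `<=` [set x | k%:R < l1norm (u x)].
  by move=> x /=; apply: le_lt_trans; rewrite ler_nat.
have nA : nonincreasing_seq (fun k => P [set x | k%:R < l1norm (u x)]).
  apply/nonincreasing_seqP => k; apply: le_measure => //; rewrite ?inE //.
split=> //; split=> //.
rewrite [X in _ --> X](_ : _ = P (\bigcap_k [set x | k%:R < l1norm (u x)])).
  apply: nonincreasing_cvg_mu => //.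
  - exact: le_lt_trans (probability_le1 _ _) (ltry _).
  - exact: bigcap_measurable.
  - by apply/nonincreasing_seqP => k; apply/subsetPset.
rewrite (_ : \bigcap_k _ = set0) ?measure0 //.
apply/seteqP; split=> // x h; have := h (Num.truncn (l1norm (u x))).+1 I.
by rewrite /= ltNge ltW // truncnS_gt.
Qed.

End random_vectors.

(** * Finitely additive measures *)

Section additive_set_functions.
Context {d : measure_display} {T : measurableType d} {R : realType}.
Implicit Types (h : set T -> R) (B C : set T).

Definition fin_add h := forall B C, measurable B -> measurable C ->
  B `&` C = set0 -> h (B `|` C) = h B + h C.

Lemma fin_add0 h : fin_add h -> h set0 = 0.
Proof.
move=> ha; have := ha set0 set0 measurable0 measurable0 (set0I _).
by rewrite setU0 => /eqP; rewrite -subr_eq subrr => /eqP.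
Qed.

Lemma fin_add_split h B C : fin_add h -> measurable B -> measurable C ->
  h B = h (B `&` C) + h (B `\` C).
Proof.
move=> ha mB mC; rewrite -ha ?setUIDK //; first exact: measurableI.
  exact: measurableD.
by rewrite setDE setIACA setICr setI0.
Qed.

Definition pos_var h B := sup [set h C | C in [set C | measurable C /\ C `<=` B]].

Lemma pos_var_ub h K B C : (forall C, measurable C -> h C <= K) ->
  measurable C -> C `<=` B -> h C <= pos_var h B.
Proof.
move=> hK mC CB; apply: ub_le_sup; last by exists C.
by exists K => _ [D [mD _] <-]; exact: hK.
Qed.

Lemma pos_var_ge0 h K B : fin_add h -> (forall C, measurable C -> h C <= K) ->
  0 <= pos_var h B.
Proof.
move=> ha hK; rewrite -(fin_add0 ha); apply: (pos_var_ub hK) => //.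
Qed.

Lemma pos_var_le h K B : (forall C, measurable C -> C `<=` B -> h C <= K) ->
  pos_var h B <= K.
Proof.
move=> hK; apply: ge_sup; first by exists (h set0); exists set0 => //; split.
by move=> _ [D [mD DB] <-]; exact: hK.
Qed.

Lemma pos_var_add h K : fin_add h -> (forall C, measurable C -> h C <= K) ->
  fin_add (pos_var h).
Proof.
move=> ha hK B C mB mC BC; apply/eqP; rewrite eq_le; apply/andP; split.
  apply: pos_var_le => D mD DBC.
  rewrite (fin_add_split ha mD mB); apply: lerD.
    by apply: (pos_var_ub hK); [exact: measurableI|exact: subIsetr].
  apply: (pos_var_ub hK); first exact: measurableD.
  by move=> x [/DBC[]].
rewrite -lerBrDr; apply: pos_var_le => D mD DB.
rewrite lerBrDr -lerBrDl; apply: pos_var_le => E mE EC.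
rewrite lerBrDl -ha //.
  by apply: (pos_var_ub hK); [exact: measurableU|exact: setUSS].
by apply: subsetI_eq0 DB EC BC.
Qed.

Lemma fin_addD h g : fin_add h -> fin_add g -> fin_add (fun B => h B + g B).
Proof. by move=> ha ga B C mB mC BC; rewrite ha // ga // addrACA. Qed.

Lemma fin_addN h : fin_add h -> fin_add (fun B => - h B).
Proof. by move=> ha B C mB mC BC; rewrite ha // opprD. Qed.

Lemma fin_add_sum (I : Type) (s : seq I) (h : I -> set T -> R) :
  (forall i, fin_add (h i)) -> fin_add (fun B => \sum_(i <- s) h i B).
Proof.
by move=> ha B C mB mC BC; rewrite -big_split; apply: eq_bigr => i _; exact: ha.
Qed.

End additive_set_functions.

(** * Total variation and integrals of simple functions *)

Section variation.
Context {d : measure_display} {T : measurableType d} {R : realType}.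
Variables (P : probability T R) (n : nat).
Implicit Types (m : set T -> 'rV[R]_n).

Lemma M1_add m j : M1 P m -> fin_add (fun B => m B ord0 j).
Proof. by case=> ma _ _ B C mB mC BC; have := ma j B C mB mC BC => -[]. Qed.

Lemma M1_bound m : M1 P m -> exists2 C, 0 <= C &
  forall B j, measurable B -> `|m B ord0 j| <= C.
Proof.
move=> [_ [C mC] _]; exists `|C| => // B j mB; exact: le_trans (mC B j mB) (ler_norm _).
Qed.

(** The variation summed over the coordinates. Unlike [abs_dual], where the norm may destroy
    additivity, it is itself finitely additive, as both the bound on simple integrals and the choice
    of a carrier require. *)
Definition tot_var m B := \sum_(j < n)
  (pos_var (fun B => m B ord0 j) B + pos_var (fun B => - m B ord0 j) B).

Section tot_var.
Variable m : set T -> 'rV[R]_n.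
Hypothesis mM : M1 P m.

Let ubs : exists K, forall j C, measurable C ->
  m C ord0 j <= K /\ - m C ord0 j <= K.
Proof.
have [K K0 mK] := M1_bound mM; exists K => j C mC.
by have := mK C j mC; rewrite ler_norml => /andP[]; lra.
Qed.

Lemma tot_var_add : fin_add (tot_var m).
Proof.
have [K h] := ubs; apply: fin_add_sum => j; apply: fin_addD.
  by apply: (@pos_var_add _ _ _ _ K) => [|C /(h j)[]//]; exact: M1_add.
apply: (@pos_var_add _ _ _ _ K) => [|C /(h j)[]//].
by apply: fin_addN; exact: M1_add.
Qed.

Let pos_ge0 j B : 0 <= pos_var (fun B => m B ord0 j) B /\
  0 <= pos_var (fun B => - m B ord0 j) B.
Proof.
have [K h] := ubs; split.
  by apply: (@pos_var_ge0 _ _ _ _ K) => [|C /(h j)[]//]; exact: M1_add.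
apply: (@pos_var_ge0 _ _ _ _ K) => [|C /(h j)[]//].
by apply: fin_addN; exact: M1_add.
Qed.

Lemma tot_var_ge0 B : 0 <= tot_var m B.
Proof. by apply: sumr_ge0 => j _; have [] := pos_ge0 j B; exact: addr_ge0. Qed.

Lemma le_tot_var B C j : measurable B -> measurable C -> C `<=` B ->
  `|m C ord0 j| <= tot_var m B.
Proof.
move=> mB mC CB; have [K h] := ubs.
have h1 : m C ord0 j <= pos_var (fun B => m B ord0 j) B.
  by apply: (@pos_var_ub _ _ _ _ K) => // D /(h j)[].
have h2 : - m C ord0 j <= pos_var (fun B => - m B ord0 j) B.
  by apply: (@pos_var_ub _ _ _ (fun B => - m B ord0 j) K) => // D /(h j)[].
have [h3 h4] := pos_ge0 j B.
rewrite /tot_var (bigD1 j) //=.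
have h5 : 0 <= \sum_(i < n | i != j) (pos_var (fun B => m B ord0 i) B +
    pos_var (fun B => - m B ord0 i) B).
  by apply: sumr_ge0 => i _; have [] := pos_ge0 i B; exact: addr_ge0.
by rewrite ler_norml; lra.
Qed.

Lemma tot_var_mono B C : measurable B -> measurable C -> C `<=` B ->
  tot_var m C <= tot_var m B.
Proof.
move=> mB mC CB; rewrite (fin_add_split tot_var_add mB mC) setIidr //.
by rewrite lerDl tot_var_ge0.
Qed.

Lemma M1_null B C : measurable B -> P B = 0%E -> measurable C -> C `<=` B -> m C = 0.
Proof.
move=> mB PB mC CB; case: mM => _ _; apply => //.
by apply/eqP; rewrite -measure_le0 -PB; apply: le_measure; rewrite ?inE.
Qed.

Local Notation simple := (fun s : seq ('rV[R]_n * set T) =>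
  fun x => \sum_(p <- s) \1_(p.2) x *: p.1).

(* By induction on [s]: split [C] along the first set and absorb its coefficient
   in [c].  The bound makes the integral of a simple function independent of its
   representation. *)
Lemma simple_integral_le (s : seq ('rV[R]_n * set T)) (c : 'rV[R]_n) C K :
  (forall p, p \in s -> measurable p.2) -> measurable C -> 0 <= K ->
  (\forall x \ae P, C x -> l1norm (c + \sum_(p <- s) \1_(p.2) x *: p.1) <= K) ->
  `|dot c (m C) + \sum_(p <- s) dot p.1 (m (p.2 `&` C))| <= K * tot_var m C.
Proof.
elim: s c C => [|[a B] s IH] c C ms mC K0 h.
  rewrite big_nil addr0.
  have [cK|Kc] := leP (l1norm c) K.
    apply: (@le_trans _ _ (l1norm c * tot_var m C)); last by rewrite ler_wpM2r ?tot_var_ge0.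
    by apply: dot_le => j; exact: le_tot_var.
  (* The assumed bound fails at every point of [C], so [C] is null and [m C] vanishes. *)
  have PC : P C = 0%E.
    case: h => A [mA PA hA]; apply/eqP; rewrite -measure_le0 -PA.
    apply: le_measure; rewrite ?inE // => x Cx; apply: hA => /(_ Cx).
    by rewrite big_nil addr0 leNgt Kc.
  by rewrite (M1_null mC PC mC) // dot0r normr0 mulr_ge0 ?tot_var_ge0.
have mB : measurable B by apply: (ms (a, B)); rewrite mem_head.
have ms' p : p \in s -> measurable p.2 by move=> ps; apply: ms; rewrite inE ps orbT.
have mCB : measurable (C `&` B) by exact: measurableI.
have mCD : measurable (C `\` B) by exact: measurableD.
have h1 := IH (c + a) _ ms' mCB K0.
have h2 := IH c _ ms' mCD K0.
rewrite big_cons /= (fin_add_split tot_var_add mC mB) mulrDr.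
have E1 : \sum_(p <- s) dot p.1 (m (p.2 `&` C)) =
    \sum_(p <- s) dot p.1 (m (p.2 `&` (C `&` B))) +
    \sum_(p <- s) dot p.1 (m (p.2 `&` (C `\` B))).
  rewrite -big_split; apply: eq_big_seq => p /ms' mp /=; rewrite -dotDr; congr dot.
  apply/matrixP => i j; rewrite ord1 mxE.
  rewrite (fin_add_split (M1_add j mM) (measurableI _ _ mp mC) mB).
  by rewrite setIA setIDA.
have E2 : m C = m (C `&` B) + m (C `\` B).
  apply/matrixP => i j; rewrite ord1 mxE.
  exact: (fin_add_split (M1_add j mM) mC mB).
rewrite E1 E2 (setIC B C) dotDr.
have {h1} : `|dot (c + a) (m (C `&` B)) +
    \sum_(p <- s) dot p.1 (m (p.2 `&` (C `&` B)))| <= K * tot_var m (C `&` B).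
  apply: h1; apply: filterS h => x h [Cx Bx]; have := h Cx.
  by rewrite big_cons /= indicE mem_set // scale1r addrA.
have {h2} : `|dot c (m (C `\` B)) +
    \sum_(p <- s) dot p.1 (m (p.2 `&` (C `\` B)))| <= K * tot_var m (C `\` B).
  apply: h2; apply: filterS h => x h [Cx Bx]; have := h Cx.
  by rewrite big_cons /= indicE memNset // scale0r add0r.
by rewrite dotDl !ler_norml; lra.
Qed.

End tot_var.
End variation.

(** * The integral on L^oo *)

Section approx.
Context {d : measure_display} {T : measurableType d} {R : realType}.

Lemma measurable_simple_approx (g : T -> R) K e : measurable_fun [set: T] g -> 0 < e ->
  exists s : seq (R * set T), (forall p, p \in s -> measurable p.2) /\
    forall x, `|g x| <= K -> `|g x - \sum_(p <- s) \1_(p.2) x * p.1| <= e.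
Proof.
move=> mg e0.
(* The levels from [i * e - K] to [(i + 1) * e - K] with [i < N0] cover the values between [- K] and
   [K]; the successor includes [K] itself. The constant [- K] is carried by [setT], and level [i]
   adds [i * e]. *)
have [N0 N0E] : exists N0, N0 = (Num.truncn (2 * K / e)).+1 by eexists.
pose B (i : nat) : set T := [set x | i%:R * e - K <= g x] `&` [set x | g x < i.+1%:R * e - K].
have mB i : measurable (B i).
  apply: measurableI; rewrite -[X in measurable X]setTI.
    exact: (measurable_fun_ler (measurable_cst _) mg).
  exact: (measurable_fun_ltr mg (measurable_cst _)).
exists ((- K, setT) :: [seq (i%:R * e, B i) | i <- iota 0 N0]); split.
  move=> p; rewrite inE => /orP[/eqP ->|/mapP[i _ ->]] //=; exact: measurableT.
move=> x gK; rewrite big_cons /= indicE in_setT mul1r big_map.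
have gK0 : 0 <= g x + K by move: gK; rewrite ler_norml => /andP[]; lra.
pose i0 := Num.truncn ((g x + K) / e).
have /andP[i0l i0r] : i0%:R <= (g x + K) / e < i0.+1%:R.
  by apply: truncn_itv; rewrite divr_ge0 // ltW.
have i0N : i0 \in iota 0 N0.
  rewrite mem_iota add0n leq0n N0E /= ltnS; apply: le_truncn.
  by rewrite ler_pM2r ?invr_gt0 //; move: gK; rewrite ler_norml => /andP[]; lra.
rewrite ler_pdivlMr // in i0l; rewrite ltr_pdivrMr // in i0r.
rewrite (bigD1_seq i0) ?iota_uniq //= big1 ?addr0; last first.
  move=> i ii0; rewrite indicE memNset ?mul0r // => -[/= h1 h2].
  move/eqP: ii0; apply; apply/esym/truncn_def.
  rewrite ler_pdivlMr // ltr_pdivrMr //; apply/andP; lra.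
rewrite indicE mem_set; last by split => /=; lra.
rewrite -natr1 in i0r.
by rewrite mul1r ler_norml; apply/andP; lra.
Qed.

End approx.

Section Linf_integral.
Context {d : measure_display} {T : measurableType d} {R : realType}.
Variables (P : probability T R) (n : nat) (N : 'rV[R]_n -> R).
Hypothesis Nnorm : is_norm N.
Local Notation rvec := (T -> 'rV[R]_n).
Implicit Types (u v : rvec) (m : set T -> 'rV[R]_n) (f : rvec -> R).

Definition Linf_bounded f := exists2 C, 0 <= C &
  forall u K, Linf P u -> ae_le P u K -> `|f u| <= C * K.

Lemma ae_le_Lnorm u j : Linf P u ->
  let L := fine (Lnorm P +oo%E (fun x => (u x ord0 j)%:E)) in
  (\forall x \ae P, `|u x ord0 j| <= L) /\
  forall K, (\forall x \ae P, `|u x ord0 j| <= K) -> 0 <= L <= K.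
Proof.
have PT : (0 < P setT)%E by rewrite probability_setT lte01.
move=> uL; set a := Lnorm _ _ _ => L.
have aE : a = ess_sup P (fun x => `|u x ord0 j|%:E) by rewrite /a unlock /Lnorm PT.
have afin : a \is a fin_num.
  rewrite ge0_fin_numE ?Lnorm_ge0 //.
  by have := uL j; rewrite !inE => /andP[_]; rewrite inE.
split.
  have := ess_sup_ge P (fun x => `|u x ord0 j|%:E).
  by apply: filterS => x; rewrite -aE -[a]fineK.
move=> K uK; rewrite /L fine_ge0 ?Lnorm_ge0 //= -lee_fin fineK // aE.
by apply/ess_supP; apply: filterS uK => x; rewrite lee_fin.
Qed.

Lemma Linf_norm_le : exists2 C, 0 < C &
  forall u K, Linf P u -> ae_le P u K -> Linf_norm P N u <= C * K.
Proof.
have [C C0 NC] := norm_le_l1norm Nnorm; exists (C * (n%:R + 1)).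
  by rewrite mulr_gt0 // ltr_pwDr.
move=> u K uL uK; rewrite /Linf_norm; apply: le_trans (NC _) _.
rewrite -mulrA ler_wpM2l ?(ltW C0) // /l1norm.
apply: (@le_trans _ _ (\sum_(j < n) K)); last first.
  rewrite sumr_const card_ord -[K *+ n]mulr_natl mulrDl mul1r lerDl.
  exact: ae_le_ge0 uK.
apply: ler_sum => j _; rewrite mxE.
have [_ h] := ae_le_Lnorm j uL.
have /h/andP[h0 hK] : \forall x \ae P, `|u x ord0 j| <= K.
  by apply: filterS uK => x; apply: le_trans; exact: coord_le_l1norm.
by rewrite ger0_norm.
Qed.

Lemma ae_le_Linf_norm : exists2 C, 0 < C &
  forall u, Linf P u -> ae_le P u (C * Linf_norm P N u).
Proof.
have [C C0 NC] := l1norm_le_norm Nnorm; exists C => // u uL.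
have h : \forall x \ae P, forall j, `|u x ord0 j| <= 
   fine (Lnorm P +oo%E (fun x => (u x ord0 j)%:E)).
  by apply: ae_forall_ord => j; have [] := ae_le_Lnorm j uL.
apply: filterS h => x h; apply: le_trans (NC _).
by apply: le_l1norm => j; rewrite mxE; exact: le_trans (h j) (ler_norm _).
Qed.

Lemma Linf_norm_ge0 u : 0 <= Linf_norm P N u.
Proof. exact: norm_ge0. Qed.

Lemma Linf_indic B (e : 'rV[R]_n) : measurable B -> Linf P (fun x => \1_B x *: e).
Proof.
move=> mB; apply: (@Linf_restr _ _ _ _ _ (fun=> e)) => //; apply/LinfP.
split; first by move=> j; exact: measurable_cst.
by exists (l1norm e); apply: nearW.
Qed.

Lemma Linf_bound_continuous f : linear_on (Linf P (n := n)) f ->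
  Linf_bounded f <->
  gen_continuous (Linf P (n := n)) [set (EFin \o Linf_norm P N : rvec -> \bar R)] f.
Proof.
move=> fl; split=> [[C C0 fC]|/(gen_continuous_at0 (Linf_lin P n) fl)].
  have [C2 C20 h] := ae_le_Linf_norm.
  apply: (@le_gen_continuous _ _ _ _ _ (EFin \o Linf_norm P N) (C * C2)) => //.
    exact: Linf_lin.
  move=> v K vL; rewrite lee_fin => vK; rewrite -mulrA; apply: fC => //.
  by apply: ae_leW (h _ vL); rewrite ler_wpM2l // ltW.
move=> [F [e [_ FQ e0 hF]]].
have {FQ}hF v : Linf P v -> Linf_norm P N v < e -> `|f v| < 1.
  by move=> vL ve; apply: hF => // q /FQ ->; rewrite lte_fin.
have [C1 C10 h] := Linf_norm_le.
exists (2 / e * C1); first by rewrite mulr_ge0 ?divr_ge0 // ltW.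
move=> u K uL uK; rewrite -(mulrA (2 / e)); apply: scaling_bound => // [|t t0 tK].
  by rewrite mulr_ge0 ?(ltW C10) // (ae_le_ge0 uK).
rewrite -(gtr0_norm t0) -normrM -(linear_onZ t (Linf_lin P n) fl uL).
have tL := lin_closedZ t (Linf_lin P n) uL.
apply: hF => //; apply: le_lt_trans tK; rewrite mulrCA; apply: h => //.
by apply: filterS uK => x uK; rewrite l1normZ gtr0_norm // ler_wpM2l // ltW.
Qed.

(** Linearity reduces simple functions to single indicators, and continuity for the norm becomes
    boundedness against almost sure bounds. The integral is handled in this form from here on. *)
Lemma is_integralP m f : is_integral P N m f <->
  [/\ linear_on (Linf P (n := n)) f, Linf_bounded f &
    forall B e, measurable B -> f (fun x => \1_B x *: e) = dot e (m B)].
Proof.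
split=> [[fl fc fs]|[fl fb fs]]; split=> //.
- exact/Linf_bound_continuous.
- move=> B e mB; have := fs 1%N (fun=> e) (fun=> B) (fun=> mB).
  rewrite big_ord1 => <-; congr f; apply/funext => x; by rewrite big_ord1.
- exact/Linf_bound_continuous.
- move=> k a B mB.
  rewrite (_ : (fun=> _) = \sum_(j < k) (fun x => \1_(B j) x *: a j)).
    have [_ ->] := linear_on_sum (index_enum _) (Linf_lin P n) fl
      (fun j => Linf_indic (a j) (mB j)).
    by apply: eq_bigr => j _; exact: fs.
  by apply/funext => x; rewrite fct_sumE.
Qed.

Local Notation simple := (fun s : seq ('rV[R]_n * set T) =>
  fun x => \sum_(p <- s) \1_(p.2) x *: p.1).

Lemma Linf_simple_dense u e : Linf P u -> 0 < e ->
  exists s : seq ('rV[R]_n * set T), (forall p, p \in s -> measurable p.2) /\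
    ae_le P (u - simple s) e.
Proof.
move=> /LinfP[mu [K uK]] e0.
(* Each of the [n] coordinates contributes an error [e']; the [+ 1] avoids a division by zero. *)
pose e' := e / (n%:R + 1); have e'0 : 0 < e' by rewrite divr_gt0 // ltr_pwDr.
have /choice[S hS] : forall j, exists s : seq (R * set T),
    (forall p, p \in s -> measurable p.2) /\ forall x, `|u x ord0 j| <= K ->
      `|u x ord0 j - \sum_(p <- s) \1_(p.2) x * p.1| <= e'.
  by move=> j; exact: measurable_simple_approx.
exists [seq (p.1 *: delta_mx ord0 j, p.2) | j <- index_enum 'I_n, p <- S j]; split.
  by move=> _ /allpairsPdep[j [p [_ pS ->]]] /=; have [h _] := hS j; exact: h.
apply: filterS uK => x uK.
apply: (@le_trans _ _ (\sum_(j < n) e')); last first.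
  rewrite sumr_const card_ord -mulr_natl /e' mulrCA ger_pMr //.
  by rewrite ler_pdivrMr ?mul1r ?lerDl // ltr_pwDr.
apply: ler_sum => j _; have [_ /(_ x)] := hS j.
move=> /(_ (le_trans (coord_le_l1norm _ _) uK)); congr (`| _ | <= _).
rewrite !fctE /= !mxE; congr (_ - _).
rewrite big_allpairs_dep summxE (bigD1 j) //= [X in _ = _ + X]big1 ?addr0.
  by rewrite summxE; apply: eq_bigr => p _; rewrite !mxE !eqxx mulr1.
move=> i ij; rewrite summxE big1 // => p _.
by rewrite !mxE eqxx eq_sym (negbTE ij) !mulr0.
Qed.

Lemma Linf_simple (s : seq ('rV[R]_n * set T)) f :
  (forall p, p \in s -> measurable p.2) -> linear_on (Linf P (n := n)) f ->
  Linf P (simple s) /\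
  f (simple s) = \sum_(p <- s) f (fun x => \1_(p.2) x *: p.1).
Proof.
move=> + fl; have Ll := Linf_lin P n; elim: s => [|p s IH] h.
  rewrite big_nil (_ : simple [::] = 0) ?(linear_on0 Ll fl); first by split=> //; case: Ll.
  by apply/funext => x; rewrite big_nil.
have [] := IH; first by move=> q qs; apply: h; rewrite inE qs orbT.
have mp := Linf_indic p.1 (h p (mem_head _ _)).
have -> : simple (p :: s) = (fun x => \1_(p.2) x *: p.1) + simple s.
  by apply/funext => x; rewrite big_cons fctE.
move=> sL fs; split; first exact: (lin_closedD Ll mp sL).
by rewrite (linear_onD Ll fl) // fs big_cons.
Qed.

Lemma Linf_ext f g : linear_on (Linf P (n := n)) f -> Linf_bounded f ->
  linear_on (Linf P (n := n)) g -> Linf_bounded g ->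
  (forall B e, measurable B -> f (fun x => \1_B x *: e) = g (fun x => \1_B x *: e)) ->
  forall u, Linf P u -> f u = g u.
Proof.
move=> fl [C C0 fb] gl [C' C'0 gb] fg u uL.
apply/eqP; rewrite -subr_eq0; apply/eqP.
apply: (@eq0_le_eps _ _ (C + C')) => e e0.
have [s [ms us]] := Linf_simple_dense uL e0.
have [sL fs] := Linf_simple ms fl; have [_ gs] := Linf_simple ms gl.
have fgs : f (simple s) = g (simple s).
  by rewrite fs gs; apply: eq_big_seq => p /ms mp; exact: fg.
have uS := lin_closedB (Linf_lin P n) uL sL.
have := fb _ _ uS us; have := gb _ _ uS us.
rewrite (linear_onB (Linf_lin P n) fl) // (linear_onB (Linf_lin P n) gl) // fgs.
by rewrite !ler_norml; lra.
Qed.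

Lemma exists_integral m : M1 P m -> exists f, is_integral P N m f.
Proof.
move=> mM.
pose G (u : rvec) (r : R) := exists s : seq ('rV[R]_n * set T),
  [/\ forall p, p \in s -> measurable p.2, u = simple s
    & r = \sum_(p <- s) dot p.1 (m p.2)].
have [f [fl h]] : exists f, linear_on (Linf P (n := n)) f /\ forall u v r K,
    G v r -> ae_le P (u - v) K -> `|f u - r| <= tot_var m setT * K.
  apply: dense_extension.
  - move=> k _ _ _ _ [s [ms -> ->]] [s' [ms' -> ->]].
    exists ([seq (k *: p.1, p.2) | p <- s] ++ s'); split.
    + by move=> p; rewrite mem_cat => /orP[/mapP[q qs ->] /=|]; [exact: ms|exact: ms'].
    + apply/funext => x; rewrite big_cat /= !fctE big_map scaler_sumr; congr (_ + _).
      by apply: eq_bigr => p _; rewrite !scalerA mulrC.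
    + rewrite big_cat big_map mulr_sumr; congr (_ + _).
      by apply: eq_bigr => p _; rewrite dotZl.
  - by move=> *; exact: ae_le_lin.
  - move=> _ _ K [s [ms -> ->]] sK.
    have := @simple_integral_le _ _ _ P n m mM s 0 setT K ms measurableT (ae_le_ge0 sK).
    rewrite dot0l add0r mulrC.
    under eq_bigr do rewrite setIT.
    apply; apply: filterS sK => x h _; by rewrite add0r.
  - move=> u uL e e0; have [s [ms us]] := Linf_simple_dense uL e0.
    by exists (simple s), (\sum_(p <- s) dot p.1 (m p.2)); split=> //; exists s.
exists f; apply/is_integralP.
have ae0 (u : rvec) : ae_le P (u - u) 0.
  by rewrite subrr; apply: nearW => x; rewrite l1norm0.
split=> //.
  exists (tot_var m setT); first exact: tot_var_ge0 mM _.
  move=> u K uL uK; have := h u 0 0 K; rewrite !subr0; apply=> //.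
  by exists [::]; split => //; rewrite ?big_nil //; apply/funext => x; rewrite big_nil.
move=> B e mB; apply/eqP; rewrite -subr_eq0 -normr_le0.
have := h (fun x => \1_B x *: e) _ (dot e (m B)) 0 _ (ae0 _).
rewrite mulr0; apply; exists [:: (e, B)]; split.
- by move=> p; rewrite inE => /eqP ->.
- by apply/funext => x; rewrite big_seq1.
- by rewrite big_seq1.
Qed.

Lemma Linf_integralP m : M1 P m -> is_integral P N m (Linf_integral P N m).
Proof. by move=> mM; apply: xgetPex; exact: exists_integral. Qed.

Lemma Linf_integral_lin m : M1 P m -> linear_on (Linf P (n := n)) (Linf_integral P N m).
Proof. by move/Linf_integralP/is_integralP => -[]. Qed.

Lemma Linf_integral_bounded m : M1 P m -> Linf_bounded (Linf_integral P N m).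
Proof. by move/Linf_integralP/is_integralP => -[]. Qed.

Lemma Linf_integral_indic m B e : M1 P m -> measurable B ->
  Linf_integral P N m (fun x => \1_B x *: e) = dot e (m B).
Proof. by move/Linf_integralP/is_integralP => -[_ _]; apply. Qed.

Lemma Linf_integral_unique m f : M1 P m ->
  linear_on (Linf P (n := n)) f -> Linf_bounded f ->
  (forall B e, measurable B -> f (fun x => \1_B x *: e) = dot e (m B)) ->
  forall u, Linf P u -> Linf_integral P N m u = f u.
Proof.
move=> mM fl fb fB; apply: Linf_ext => //.
- exact: Linf_integral_lin.
- exact: Linf_integral_bounded.
- by move=> B e mB; rewrite Linf_integral_indic // fB.
Qed.

Lemma Linf_integral_comb k m m' m'' : M1 P m -> M1 P m' -> M1 P m'' ->
  (forall B, measurable B -> m'' B = k *: m B + m' B) ->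
  forall u, Linf P u ->
    Linf_integral P N m'' u = k * Linf_integral P N m u + Linf_integral P N m' u.
Proof.
move=> mM m'M m''M E.
have [l [C C0 b]] := (Linf_integral_lin mM, Linf_integral_bounded mM).
have [l' [C' C'0 b']] := (Linf_integral_lin m'M, Linf_integral_bounded m'M).
apply: (Linf_integral_unique m''M).
- by move=> a u v uL vL; rewrite l // l' //; ring.
- exists (`|k| * C + C'); first by rewrite addr_ge0 // mulr_ge0.
  move=> u K uL uK; have h := b _ _ uL uK; have h' := b' _ _ uL uK.
  apply: le_trans (ler_normD _ _) _; rewrite normrM mulrDl; apply: lerD => //.
  by rewrite -mulrA ler_wpM2l.
- by move=> B e mB; rewrite !Linf_integral_indic // E // dotDr dotZr.
Qed.

End Linf_integral.

(** * The extended integral *)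

Section clip.
Context {R : realType}.
Implicit Types a t : R.

Definition clip a t := Num.max (- a) (Num.min a t).

Lemma clip_cases a t : 0 <= a ->
  [\/ clip a t = t /\ `|t| <= a, clip a t = a /\ a < t | clip a t = - a /\ t < - a].
Proof.
move=> a0; rewrite /clip; case: (leP a t) => [at_|ta].
  have -> : Num.max (- a) a = a by apply/max_idPr; lra.
  move: at_; rewrite le_eqVlt => /predU1P[<-|at_]; last by constructor 2.
  by constructor 1; rewrite ger0_norm.
case: (leP (- a) t) => [h|h]; last by constructor 3.
by constructor 1; split=> //; rewrite ler_norml; lra.
Qed.

Lemma normr_cases t : (`|t| = t /\ 0 <= t) \/ (`|t| = - t /\ t <= 0).
Proof.
by case: (leP 0 t) => h; [left; rewrite ger0_norm|right; rewrite ltr0_norm // ltW].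
Qed.

Lemma clip_le a t : 0 <= a -> `|clip a t| <= a /\ `|clip a t| <= `|t|.
Proof.
move=> a0; have [[-> ?]|[-> ?]|[-> ?]] := clip_cases t a0; split=> //;
 rewrite ?normrN (ger0_norm a0) //;
 by have [[E ?]|[E ?]] := normr_cases t; rewrite E; lra.
Qed.

Lemma clip_sub_le a t y : 0 <= a -> 0 <= y -> `|t| <= a + y -> `|t - clip a t| <= y.
Proof.
move=> a0 y0; have [[-> ?]|[-> ?]|[-> ?]] := clip_cases t a0;
 rewrite ?subrr ?normr0 //; have [[E ?]|[E ?]] := normr_cases t; rewrite E => ?;
 rewrite ler_norml; lra.
Qed.

(** Where clipping changes nothing, [y] vanishes; elsewhere [|t|] exceeds [a] by exactly the room
    that [y] may take. *)
Lemma clip_add_le a t (z y : R) : 0 <= a -> `|z| <= a -> `|z| <= `|t| ->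
  `|y| <= `|t - clip a t| -> `|z + y| <= `|t|.
Proof.
move=> a0 za zt yt; apply: le_trans (ler_normD _ _) _; move: yt.
have [[-> ?]|[-> ?]|[-> ?]] := clip_cases t a0.
- by rewrite subrr normr0; lra.
- by rewrite (ger0_norm (_ : 0 <= t - a)) ?(ger0_norm (_ : 0 <= t)); lra.
- by rewrite (ler0_norm (_ : t - - a <= 0)) ?(ler0_norm (_ : t <= 0)); lra.
Qed.

End clip.

Section extended_integral.
Context {d : measure_display} {T : measurableType d} {R : realType}.
Variables (P : probability T R) (n : nat) (N : 'rV[R]_n -> R).
Hypothesis Nnorm : is_norm N.
Local Notation rvec := (T -> 'rV[R]_n).
Implicit Types (u v z : rvec) (f : rvec -> R).

Definition vclip (a u : rvec) : rvec :=
  fun x => \row_j clip `|a x ord0 j| (u x ord0 j).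

Lemma meas_vclip a u : meas_rv a -> meas_rv u -> meas_rv (vclip a u).
Proof.
move=> ma mu j.
have mna : measurable_fun [set: T] (fun x => `|a x ord0 j|).
  by apply: measurableT_comp => //; exact: ma.
rewrite (_ : (fun=> _) = (fun x => Num.max (- `|a x ord0 j|)
  (Num.min `|a x ord0 j| (u x ord0 j)))); last by apply/funext => x; rewrite mxE.
apply: measurable_maxr; first exact: measurableT_comp.
by apply: measurable_minr => //; exact: mu.
Qed.

Lemma Linf_dom u v : meas_rv u -> Linf P v ->
  (forall j, \forall x \ae P, `|u x ord0 j| <= `|v x ord0 j|) -> Linf P u.
Proof.
move=> mu /LinfP[mv [K vK]] uv; apply/LinfP; split=> //; exists K.
have uv' := ae_forall_ord uv; near=> x; apply: (@le_trans _ _ (l1norm (v x))).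
  by apply: le_l1norm; near: x.
by near: x.
Unshelve. all: by end_near. Qed.

Section fixed_measure.
Variable m : set T -> 'rV[R]_n.
Hypothesis mM : M1 P m.
Local Notation I := (Linf_integral P N m).
Local Notation rho := (rho P N m).
Let Ll := Linf_lin P n.
Let Il : linear_on (Linf P (n := n)) I := Linf_integral_lin Nnorm mM.

Lemma rho_ub u z : Linf P z ->
  (forall j, \forall x \ae P, `|z x ord0 j| <= `|u x ord0 j|) ->
  ((I z)%:E <= rho u)%E.
Proof. by move=> zL zu; apply: ereal_sup_ubound; exists z. Qed.

Lemma rho_le u K : (forall z, Linf P z ->
    (forall j, \forall x \ae P, `|z x ord0 j| <= `|u x ord0 j|) -> I z <= K) ->
  (rho u <= K%:E)%E.
Proof.
by move=> h; apply: ge_ereal_sup => _ [z [zL zu] <-]; rewrite lee_fin h.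
Qed.

Lemma rho_ge0 u : (0 <= rho u)%E.
Proof.
have := @rho_ub u 0; rewrite (linear_on0 Ll Il); apply; first by case: Ll.
by move=> j; apply: nearW => x; rewrite mxE normr0.
Qed.

Lemma Linf_integral_ae0 z : Linf P z ->
  (forall j, \forall x \ae P, `|z x ord0 j| <= 0) -> I z = 0.
Proof.
move=> zL z0; have [C C0 h] := Linf_integral_bounded Nnorm mM.
apply/eqP; rewrite -normr_le0 -(mulr0 C); apply: h => //.
have := ae_forall_ord z0; apply: filterS => x zx; rewrite -(@l1norm0 R n).
by apply: le_l1norm => j; rewrite mxE normr0.
Qed.

(** Measurability is carried along because the truncation in [rho_lin] has to be measurable in order
    to lie in L^oo. *)
Definition rho_bounded u K := meas_rv u /\ (rho u <= K%:E)%E.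

(* Riesz decomposition: a [z] dominated by [k u + v] is the sum of its truncation
   by [k u] and of a remainder dominated by [v]. *)
Lemma rho_lin k u K v L : rho_bounded u K -> rho_bounded v L ->
  rho_bounded (k *: u + v) (`|k| * K + L).
Proof.
move=> [mu uK] [mv vL]; split; first by case: (@meas_rv_lin _ T R n) => _; exact.
have mku : meas_rv (k *: u) := lin_closedZ k (@meas_rv_lin _ T R n) mu.
apply: rho_le => z zL zuv.
pose z1 := vclip (k *: u) z.
have z1L : Linf P z1.
  apply: (Linf_dom _ zL); first exact: meas_vclip (Linf_meas zL).
  by move=> j; apply: nearW => x; rewrite mxE;
    have [] := clip_le (z x ord0 j) (normr_ge0 ((k *: u) x ord0 j)).
have z2L : Linf P (z - z1) := lin_closedB Ll zL z1L.
have -> : z = z1 + (z - z1) by rewrite addrC subrK.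
rewrite (linear_onD Ll Il) //; apply: lerD; last first.
  rewrite -lee_fin; apply: le_trans vL; apply: rho_ub => // j.
  apply: filterS (zuv j) => x h; rewrite !fctE !mxE; apply: clip_sub_le => //.
  by apply: le_trans h _; rewrite !fctE !mxE; exact: ler_normD.
have z1u j : \forall x \ae P, `|z1 x ord0 j| <= `|k| * `|u x ord0 j|.
  apply: nearW => x; rewrite mxE.
  have [] := clip_le (z x ord0 j) (normr_ge0 ((k *: u) x ord0 j)).
  by rewrite -normrM [in X in _ <= X]fctE mxE.
have [k0|k0] := eqVneq k 0.
  rewrite Linf_integral_ae0 // ?k0 ?normr0 ?mul0r // => j.
  by apply: filterS (z1u j) => x; rewrite k0 normr0 mul0r.
have k0' : 0 < `|k| by rewrite normr_gt0.
rewrite -[z1](scalerKV (lt0r_neq0 k0')) (linear_onZ _ Ll Il); last exact: (lin_closedZ _ Ll z1L).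
rewrite ler_pM2l // -lee_fin; apply: le_trans uK; apply: rho_ub.
  exact: (lin_closedZ _ Ll z1L).
move=> j; apply: filterS (z1u j) => x h.
by rewrite fctE mxE normrM normfV normr_id ler_pdivrMl.
Qed.

Lemma rho_fin u : (rho u < +oo)%E -> rho u = (fine (rho u))%:E.
Proof. by move=> h; rewrite fineK // ge0_fin_numE // rho_ge0. Qed.

Lemma dom_rho_lin : lin_closed (dom P rho).
Proof.
have L1l := L1_lin P n.
split=> [|k u v [uL uf] [vL vf]]; split.
- by case: L1l.
- apply: (@le_lt_trans _ _ 0%E); last exact: ltry.
  apply: rho_le => z zL z0; rewrite Linf_integral_ae0 // => j.
  by apply: filterS (z0 j) => x; rewrite [in X in _ <= X]mxE normr0.
- by case: L1l => _; exact.
have [] := @rho_lin k u (fine (rho u)) v (fine (rho v)).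
- by split; [exact: L1_meas|rewrite -rho_fin].
- by split; [exact: L1_meas|rewrite -rho_fin].
by move=> _ /le_lt_trans; apply; exact: ltry.
Qed.

Lemma rho_adherent u e : (rho u < +oo)%E -> 0 < e -> exists z,
  [/\ Linf P z, forall j, \forall x \ae P, `|z x ord0 j| <= `|u x ord0 j|
    & (rho u <= (I z + e)%:E)%E].
Proof.
move=> uf e0; have ufin : rho u \is a fin_num by rewrite ge0_fin_numE ?rho_ge0.
have [_ [z [zL zu] <-] h] := ub_ereal_sup_adherent e0 ufin.
exists z; split=> //; move/ltW: h; rewrite -/(rho u).
by rewrite leeBlDr // EFinD.
Qed.

(* If [z] almost attains [rho u] and [K] bounds [z], truncate [u] at height [K]:
   whatever is dominated by the part cut off can be added to [z] without leaving
   the order interval of [u], so that its integral is small. *)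
Lemma rho_dense u e : dom P rho u -> 0 < e ->
  exists2 v, Linf P v & rho_bounded (u - v) e.
Proof.
move=> [uL1 uf] e0; have mu := L1_meas uL1.
have [z [zL zu zI]] := rho_adherent uf e0.
have [mz [K zK]] := iffLR (LinfP P z) zL; have K0 := ae_le_ge0 zK.
pose c : rvec := fun=> \row_j K.
have mc : meas_rv c by move=> j; exact: measurable_cst.
have cL : Linf P c.
  by apply/LinfP; split=> //; exists (l1norm (\row_(j < n) K)); exact: nearW.
have cE x j : `|c x ord0 j| = K by rewrite mxE ger0_norm.
pose v := vclip c u.
have vL : Linf P v.
  apply: (Linf_dom _ cL); first exact: meas_vclip.
  move=> j; apply: nearW => x; rewrite [in X in X <= _]mxE.
  by have [] := clip_le (u x ord0 j) (normr_ge0 (c x ord0 j)).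
exists v => //; split.
  exact: lin_closedB (@meas_rv_lin _ T R n) mu (Linf_meas vL).
apply: rho_le => y yL yu.
have : ((I (z + y))%:E <= rho u)%E.
  apply: rho_ub; first exact: (lin_closedD Ll).
  move=> j; near=> x; rewrite fctE mxE; apply: (@clip_add_le _ K) => //.
  - by apply: le_trans (coord_le_l1norm _ _) _; near: x.
  - by near: x.
  - by rewrite -(cE x j); near: x; apply: filterS (yu j) => x; rewrite !fctE !mxE.
move=> /le_trans /(_ zI); rewrite lee_fin (linear_onD Ll Il) //.
by rewrite lerD2l.
Unshelve. all: by end_near. Qed.

Lemma exists_extended_integral : exists f, is_extended_integral P N m f.
Proof.
have [f [fl h]] : exists f, linear_on (dom P rho) f /\ forall u v r K,
    (Linf P v /\ r = I v) -> rho_bounded (u - v) K -> `|f u - r| <= 1 * K.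
  apply: dense_extension.
  - move=> k u r v s [uL ->] [vL ->]; split; first by case: Ll => _; exact.
    by rewrite Il.
  - exact: rho_lin.
  (* Both [u] and [- u] lie in the order interval of [u], so [|I u|] is at most [rho u]. *)
  - move=> u r K [uL ->] [_ uK]; rewrite mul1r ler_norml; apply/andP; split.
      rewrite lerNl -(linear_onN Ll Il) // -lee_fin; apply: le_trans uK.
      apply: rho_ub; first exact: (lin_closedN Ll uL).
      by move=> j; apply: nearW => x; rewrite fctE mxE normrN.
    by rewrite -lee_fin; apply: le_trans uK; apply: rho_ub => // j; exact: nearW.
  - move=> u uD e e0; have [v vL uv] := rho_dense uD e0.
    by exists v, (I v).
exists f; split=> //.
- apply: (@le_gen_continuous _ _ _ _ _ rho 1) => //; first exact: dom_rho_lin.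
  move=> v K [vL _] vK; have := h v 0 0 K; rewrite !subr0; apply.
    by split; [case: Ll|rewrite (linear_on0 Ll Il)].
  by split=> //; exact: L1_meas.
- move=> u uL; apply/eqP; rewrite -subr_eq0 -normr_le0 -(mulr0 1).
  apply: (h u u) => //; rewrite subrr; split; first by case: (@meas_rv_lin _ T R n).
  apply: rho_le => z zL z0; rewrite Linf_integral_ae0 // => j.
  by apply: filterS (z0 j) => x; rewrite [in X in _ <= X]mxE normr0.
Qed.

Lemma integral_faP : is_extended_integral P N m (integral_fa P N m).
Proof. by apply: xgetPex; exact: exists_extended_integral. Qed.

Lemma integral_fa_lin : linear_on (dom P rho) (integral_fa P N m).
Proof. by case: integral_faP. Qed.

Lemma integral_fa_Linf u : Linf P u -> integral_fa P N m u = I u.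
Proof. by case: integral_faP => _ _; exact. Qed.

(** The chosen extension is known to be continuous, which yields some constant [C]. It disappears in
    [integral_fa_le], where it multiplies an arbitrarily small error. *)
Lemma integral_fa_bounded : exists2 C : R, 0 <= C & forall u (K : R), dom P rho u ->
  0 < K -> (rho u <= K%:E)%E -> `|integral_fa P N m u| <= C * K.
Proof.
have [fl fc _] := integral_faP.
have [F [e [_ FQ e0 hF]]] := gen_continuous_at0 dom_rho_lin fl fc.
exists (2 / e); first by rewrite divr_ge0 // ltW.
move=> u K uD K0 uK; apply: scaling_bound => // [|t t0 tK]; first exact: ltW.
rewrite -(gtr0_norm t0) -normrM -(linear_onZ t dom_rho_lin fl uD).
apply: hF => [|q /FQ ->]; first exact: (lin_closedZ t dom_rho_lin uD).
have [] := @rho_lin t u K 0 0.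
- by split=> //; case: uD => /L1_meas.
- split; first by case: (@meas_rv_lin _ T R n).
  apply: rho_le => z zL z0; rewrite Linf_integral_ae0 // => j.
  by apply: filterS (z0 j) => x; rewrite [in X in _ <= X]mxE normr0.
by move=> _; rewrite !addr0 gtr0_norm // => /le_lt_trans; apply; rewrite lte_fin.
Qed.

End fixed_measure.

(** The defining properties of both integrals see a measure on measurable sets alone, so the
    predicates from which [xget] chooses coincide. *)
Lemma integral_fa_eq (m m' : set T -> 'rV[R]_n) : (forall B, measurable B -> m B = m' B) ->
  Linf_integral P N m = Linf_integral P N m' /\ integral_fa P N m = integral_fa P N m'.
Proof.
move=> mm'.
have E : Linf_integral P N m = Linf_integral P N m'.
  congr xget; apply/predeqP => f; split=> -[fl fc fs]; split=> // k a B mB;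
  rewrite fs //; apply: eq_bigr => j _; by rewrite mm'.
split=> //; rewrite /integral_fa /is_extended_integral.
have -> : Defs.rho P N m = Defs.rho P N m' by apply/funext => u; rewrite /Defs.rho E.
by rewrite E.
Qed.

End extended_integral.

(** * The space U *)

Lemma le_eps {R : realType} (x y L : R) : (forall e, 0 < e -> x <= y + L * e) -> x <= y.
Proof.
move=> h; apply/ler_addgt0Pr => e e0; have L1 : 0 < `|L| + 1 by rewrite ltr_pwDr.
have := h (e / (`|L| + 1)); rewrite divr_gt0 // => /(_ isT) /le_trans; apply.
rewrite lerD2l mulrCA ger_pMr // ler_pdivrMr // mul1r.
by have := ler_norm L; lra.
Qed.

Section Uspace.
Context {d : measure_display} {T : measurableType d} {R : realType}.
Variables (P : probability T R) (n : nat) (N : 'rV[R]_n -> R).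
Local Notation rvec := (T -> 'rV[R]_n).
Variable PP : set (rvec -> \bar R).
Hypothesis n0 : (0 < n)%N.
Hypothesis Nnorm : is_norm N.
Hypothesis PPsub : forall p, PP p -> sublinear_symmetric P p.
Hypothesis PP1 : A1 P N PP.
Hypothesis PP2 : forall p, PP p -> A2 P N p.
Hypothesis PP3 : forall p, PP p -> A3 P N PP p.
Local Notation U := (Uspace P PP).
Implicit Types (u v z : rvec) (f w : rvec -> R) (p : rvec -> \bar R).
Implicit Types (m : set T -> 'rV[R]_n).
Let Ll := Linf_lin P n.
Let L1l := L1_lin P n.

(** [0 = p (u - u) <= p u + p (- u)], and symmetry makes the two summands equal. *)
Lemma sublinear_ge0 p u : PP p -> L1 P u -> (0 <= p u)%E.
Proof.
move=> Pp uL; have [_ p0 _ pD pN] := PPsub Pp.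
have := pD u (- u) uL (lin_closedN L1l uL); rewrite subrr p0 pN //.
by case: (p u) => [r| |] //; rewrite -EFinD !lee_fin => h; lra.
Qed.

Lemma sublinear_comb p k u v (K L : R) : PP p -> L1 P u -> L1 P v ->
  (p u <= K%:E)%E -> (p v <= L%:E)%E -> (p (k *: u + v)%R <= (`|k| * K + L)%:E)%E.
Proof.
move=> Pp uL vL uK vL'; have [_ p0 pZ pD pN] := PPsub Pp.
have kuL := lin_closedZ k L1l uL.
apply: le_trans (pD _ _ kuL vL) _; rewrite EFinD; apply: leeD => //.
have pos a : 0 < a -> (p (a *: u) <= (a * K)%:E)%E.
  by move=> a0; rewrite pZ // EFinM lee_pmul2l.
have [k0|k0|->] := ltgtP k 0; last by rewrite scale0r p0 normr0 mul0r.
  by rewrite -pN // -scaleNr ltr0_norm // pos // oppr_gt0.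
by rewrite gtr0_norm // pos.
Qed.

Lemma sublinearZ_le p k u (K : R) : PP p -> L1 P u -> (p u <= K%:E)%E ->
  (p (k *: u)%R <= (`|k| * K)%:E)%E.
Proof.
move=> Pp uL uK; have [_ p0 _ _ _] := PPsub Pp.
have := @sublinear_comb p k u 0 K 0 Pp uL (proj1 L1l) uK.
by rewrite p0 lexx !addr0 => /(_ isT).
Qed.

Lemma Uspace_L1 u : U u -> L1 P u. Proof. by case. Qed.

Lemma Uspace_meas u : U u -> meas_rv u.
Proof. by move/Uspace_L1/L1_meas. Qed.

Lemma sublinear_fine p u : PP p -> U u -> p u = (fine (p u))%:E.
Proof.
move=> Pp [uL h]; rewrite fineK // ge0_fin_numE; first by have [] := h _ Pp.
exact: sublinear_ge0.
Qed.

Lemma fine_sublinear_ge0 p u : PP p -> U u -> 0 <= fine (p u).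
Proof. by move=> Pp uU; rewrite fine_ge0 // sublinear_ge0 //; exact: Uspace_L1. Qed.

Lemma Uspace_lin : lin_closed U.
Proof.
split; [split|move=> k u v uU vU; split].
- by case: L1l.
- move=> p Pp; split; first by case: L1l.
  by have [_ -> _ _ _] := PPsub Pp; exact: ltry.
- by case: L1l => _; apply; exact: Uspace_L1.
move=> p Pp; split; first by case: L1l => _; apply; exact: Uspace_L1.
have [uL vL] := (Uspace_L1 uU, Uspace_L1 vU).
have := @sublinear_comb p k u v (fine (p u)) (fine (p v)) Pp uL vL.
rewrite -!sublinear_fine // !lexx => /(_ isT isT) /le_lt_trans; apply.
exact: ltry.
Qed.

Lemma sublinear_Linf p : PP p -> exists2 c : R, 0 <= c & forall u K,
  Linf P u -> ae_le P u K -> (p u <= (c * K)%:E)%E.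
Proof.
move=> Pp; have [c h] := PP2 Pp; have [C C0 hC] := Linf_norm_le P Nnorm.
exists (`|c| * C); first by rewrite mulr_ge0 // ltW.
move=> u K uL uK; apply: le_trans (h u uL) _; rewrite lee_fin -mulrA.
have := hC _ _ uL uK; have := Linf_norm_ge0 P Nnorm u; have := ler_norm c.
move=> c1 l0 l1; apply: (@le_trans _ _ (`|c| * Linf_norm P N u)).
  by rewrite ler_wpM2r.
by rewrite ler_wpM2l.
Qed.

Lemma Linf_Uspace u : Linf P u -> U u.
Proof.
move=> uL; split; first exact: Linf_L1.
move=> p Pp; split; first exact: Linf_L1.
have [_ [K uK]] := iffLR (LinfP P u) uL.
have [c c0 h] := sublinear_Linf Pp; apply: le_lt_trans (h _ _ uL uK) _.
exact: ltry.
Qed.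

(* [N] need not be monotone, so that coordinatewise domination is compatible with
   (A3) only up to a constant. *)
Lemma sublinear_dom : exists2 C : R, 0 < C & forall p u v (k : R), PP p -> U u ->
  0 < k -> meas_rv v -> (\forall x \ae P, l1norm (v x) <= k * l1norm (u x)) ->
  (p v <= (C * k * fine (p u))%:E)%E.
Proof.
have [C C0 h] := norm_equiv Nnorm; exists (C * C); first by rewrite mulr_gt0.
move=> p u v k Pp uU k0 mv vu.
have vL : L1 P v by exact: L1_dom (Uspace_L1 uU) mv vu.
have c0 : 0 < C * C * k by rewrite !mulr_gt0.
(* After division by [C * C * k] the vector [v] is dominated by [u] in [N], so that (A3) applies:
   one factor [C] is lost in passing from [N] to [l1norm], the other in passing back. *)
have -> : v = (C * C * k) *: ((C * C * k)^-1 *: v).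
  by rewrite scalerA divff ?scale1r // gt_eqF.
have vL' := lin_closedZ (C * C * k)^-1 L1l vL.
have := @sublinearZ_le p (C * C * k) _ (fine (p u)) Pp vL'.
rewrite gtr0_norm //; apply; rewrite -sublinear_fine //.
apply: (PP3 Pp) => //; apply: filterS vu => x vx.
have [_ NZ _] := Nnorm; rewrite fctE NZ normfV gtr0_norm // ler_pdivrMl //.
apply: le_trans (proj1 (h _)) _; rewrite -!mulrA ler_pM2l //.
apply: le_trans vx _; rewrite [C * (k * _)]mulrCA ler_pM2l //.
exact: (proj2 (h _)).
Qed.

Lemma Uspace_dom u v (k : R) : U u -> 0 < k -> meas_rv v ->
  (\forall x \ae P, l1norm (v x) <= k * l1norm (u x)) -> U v.
Proof.
move=> uU k0 mv vu; have vL : L1 P v by exact: L1_dom (Uspace_L1 uU) mv vu.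
have [C C0 h] := sublinear_dom.
split=> // p Pp; split=> //; apply: le_lt_trans (h p u v k Pp uU k0 mv vu) _.
exact: ltry.
Qed.

Lemma restr_Uspace u B : measurable B -> U u -> U (restr u B).
Proof.
move=> mB uU; apply: (@Uspace_dom u _ 1) => //.
  by apply: meas_restr => //; exact: Uspace_meas.
by apply: nearW => x; rewrite mul1r; exact: l1norm_restr.
Qed.

Lemma sublinear_restr p u B : PP p -> measurable B -> U u ->
  (p (restr u B) <= p u)%E.
Proof.
move=> Pp mB uU; apply: (PP3 Pp) => //.
  exact/Uspace_L1/restr_Uspace.
apply: nearW => x; have [Bx|Bx] := pselect (B x); first by rewrite restr_in.
by rewrite restr_out // (norm_0 Nnorm) norm_ge0.
Qed.

(* For empty [PP] the topology of [U] would be trivial, against (A1). *)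
Lemma PP_nonempty : exists p, PP p.
Proof.
apply: contrapT => /forallNP PP0; have [U0 _] := Uspace_lin.
have [|F [e [_ FP e0 h]]] := @PP1 _ U0 [set v | (L1_norm P N v < 1%:E)%E].
  exists [set L1_norm P N], 1; split=> //.
  by move=> v [_ /(_ _ erefl)]; rewrite subr0.
pose v0 := delta_mx ord0 (Ordinal n0) : 'rV[R]_n.
have v0N : 0 < N v0.
  rewrite lt_neqAle norm_ge0 // andbT eq_sym; apply/eqP => Nv0.
  have [Nd _ _] := Nnorm; move/matrixP: (Nd _ Nv0) => /(_ ord0 (Ordinal n0)).
  by rewrite !mxE !eqxx => /eqP; rewrite oner_eq0.
(* A constant vector with [N (v x) = 1] has L^1 norm 1, hence lies outside the open unit ball,
   although no seminorm excludes it. *)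
pose v : rvec := fun=> (N v0)^-1 *: v0.
have vL : Linf P v.
  apply/LinfP; split; first by move=> j; exact: measurable_cst.
  by exists (l1norm ((N v0)^-1 *: v0)); exact: nearW.
have /h : U v /\ forall q, F q -> (q (v - 0)%R < e%:E)%E.
  by split; [exact: Linf_Uspace|move=> q /FP /PP0].
rewrite /= /L1_norm (_ : N \o v = cst 1) ?expectation_cst ?ltxx //.
apply/funext => x; rewrite /= /v; have [_ NZ _] := Nnorm.
by rewrite NZ normfV gtr0_norm // mulVf // gt_eqF.
Qed.

Lemma top_dual_bound p f (L : R) : PP p -> linear_on U f ->
  (forall u, U u -> `|f u| <= L * fine (p u)) -> top_dual P PP f.
Proof.
move=> Pp fl fb; split=> //.
apply: (@le_gen_continuous _ _ _ _ _ p `|L|) => //; first exact: Uspace_lin.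
move=> v K vU vK; apply: le_trans (fb _ vU) _.
rewrite sublinear_fine // lee_fin in vK.
have := fine_sublinear_ge0 Pp vU; have := ler_norm L; have := normr_ge0 L; nra.
Qed.

Lemma top_dual_comb f g k : top_dual P PP f -> top_dual P PP g ->
  top_dual P PP (fun u => k * f u + g u).
Proof.
move=> [fl fc] [gl gc]; split; last exact: gen_continuous_comb.
by move=> a u v uU vU; rewrite fl // gl //; ring.
Qed.

(** * The integral on U against a measure of finite polar *)

Section polar.
Variables (p : rvec -> \bar R) (m : set T -> 'rV[R]_n).
Hypothesis Pp : PP p.
Hypothesis mM : M1 P m.
Local Notation I := (Linf_integral P N m).
Local Notation rho := (rho P N m).
Let Il : linear_on (Linf P (n := n)) I := Linf_integral_lin Nnorm mM.

Lemma polar_ge0 : (0 <= polar P N p m)%E.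
Proof.
apply: ereal_sup_ubound; exists 0; last by rewrite (linear_on0 Ll Il).
split; first by case: Ll.
by have [_ -> _ _ _] := PPsub Pp; rewrite lee_fin ler01.
Qed.

Lemma polar_le (L : R) :
  (forall v, Linf P v -> I v <= L * fine (p v)) -> 0 <= L ->
  (polar P N p m <= L%:E)%E.
Proof.
move=> h L0; apply: ge_ereal_sup => _ [v [vL v1] <-]; rewrite lee_fin.
apply: le_trans (h _ vL) _; have vU := Linf_Uspace vL.
rewrite sublinear_fine // lee_fin in v1.
by have := fine_sublinear_ge0 Pp vU; nra.
Qed.

Hypothesis pm : (polar P N p m < +oo)%E.
Let L := fine (polar P N p m).

Let pmE : polar P N p m = L%:E.
Proof. by rewrite fineK // ge0_fin_numE // polar_ge0. Qed.

Let L0 : 0 <= L.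
Proof. by rewrite fine_ge0 // polar_ge0. Qed.

Lemma Linf_integral_polar v (K : R) : Linf P v -> (p v <= K%:E)%E -> `|I v| <= L * K.
Proof.
have half z : Linf P z -> (p z <= K%:E)%E -> I z <= L * K.
  move=> zL zK; apply: (@le_eps _ _ _ L) => e e0.
  have K0 : 0 <= K.
    by rewrite -lee_fin; apply: le_trans zK; apply: sublinear_ge0 => //; exact: Linf_L1.
  (* Scaling by [K + e] instead of [K] covers the case [K = 0]. *)
  have Ke : 0 < K + e by rewrite ltr_wpDl.
  have zL' := lin_closedZ (K + e)^-1 Ll zL.
  have : ((I ((K + e)^-1 *: z))%:E <= L%:E)%E.
    rewrite -pmE; apply: ereal_sup_ubound; exists ((K + e)^-1 *: z) => //; split=> //.
    apply: le_trans (sublinearZ_le _ Pp (Linf_L1 zL) zK) _.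
    rewrite lee_fin normfV gtr0_norm // ler_pdivrMl // mulr1 lerDl; exact: ltW.
  rewrite lee_fin (linear_onZ _ Ll Il) // ler_pdivrMl //.
  by move/le_trans; apply; rewrite mulrC mulrDr.
move=> vL vK; rewrite ler_norml half // andbT lerNl -(linear_onN Ll Il) //.
have [_ _ _ _ pN] := PPsub Pp.
apply: half; first exact: (lin_closedN Ll vL).
by rewrite pN //; exact: Linf_L1.
Qed.

(** Whatever lies in the order interval of [u] is controlled in [p] by [sublinear_dom], and the
    polar then bounds its integral. This places U inside the domain of [rho], with a constant that
    only [integral_fa_le] makes sharp. *)
Lemma Uspace_rho : exists2 C : R, 0 < C & forall u, U u ->
  (rho u <= (C * fine (p u))%:E)%E.
Proof.
have [C C0 h] := sublinear_dom; exists (C * (L + 1)).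
  by rewrite mulr_gt0 // ltr_pwDr.
move=> u uU; apply: rho_le => z zL zu.
have zp : (p z <= (C * 1 * fine (p u))%:E)%E.
  apply: h => //; first exact: Linf_meas zL.
  have := ae_forall_ord zu; apply: filterS => x zux.
  by rewrite mul1r; exact: le_l1norm.
have := Linf_integral_polar zL zp; rewrite mulr1.
have : 0 <= C * fine (p u) by rewrite mulr_ge0 ?fine_sublinear_ge0 // ltW.
by rewrite ler_norml => ? /andP[_]; lra.
Qed.

Lemma Uspace_dom_rho u : U u -> dom P rho u.
Proof.
move=> uU; split; first exact: Uspace_L1.
have [C C0 h] := Uspace_rho; apply: le_lt_trans (h _ uU) _; exact: ltry.
Qed.

Lemma integral_fa_linU : linear_on U (integral_fa P N m).
Proof.
by move=> k u v uU vU; apply: (integral_fa_lin Nnorm mM); exact: Uspace_dom_rho.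
Qed.

(* All coordinates are cut on the same set: [N (restr u B x) <= N (u x)] for any
   set [B], whereas truncating them separately may increase [N]. *)
Lemma rho_tail u e : U u -> 0 < e -> exists k : R,
  (rho (restr u [set x | (k < l1norm (u x))%R]) <= e%:E)%E.
Proof.
move=> uU e0; have mu := Uspace_meas uU.
have e2 : 0 < e / 2 by rewrite divr_gt0.
have [_ uf] := Uspace_dom_rho uU.
have [z [zL zu zI]] := rho_adherent Nnorm mM uf e2.
have [mz [K zK]] := iffLR (LinfP P z) zL; have K0 := ae_le_ge0 zK.
have [C C0 h] := sublinear_dom.
have pu0 := fine_sublinear_ge0 Pp uU.
(* On [B] the bound [K] of [z] is below [(K + 1) / k] times [l1norm (u x)], so [I (restr z B)] is at
   most [L * C * fine (p u)] times [(K + 1) / k]. This [k] makes that at most [e / 2]; the last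
   [+ 1] keeps [k] positive. *)
pose k := (L * (C * (K + 1) * fine (p u))) / (e / 2) + 1.
have k0 : 0 < k.
  rewrite ltr_wpDl // divr_ge0 //; last exact: ltW.
  by rewrite !mulr_ge0 ?addr_ge0 // ltW.
exists k; set B := [set x | _].
have mB : measurable B by exact: meas_l1norm_gt.
have mBC := measurableC mB.
have zBL := Linf_restr mB zL; have zBCL := Linf_restr mBC zL.
have K1k : 0 < (K + 1) / k by rewrite divr_gt0 // ltr_wpDl.
have zBp : (p (restr z B) <= (C * ((K + 1) / k) * fine (p u))%:E)%E.
  apply: h => //; first exact: Linf_meas.
  apply: filterS zK => x zx; have [Bx|Bx] := pselect (B x).
    rewrite restr_in // (le_trans zx) // mulrAC ler_pdivlMr //.
    by move: Bx; rewrite /B /= => Bx; nra.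
  by rewrite restr_out // l1norm0 mulr_ge0 ?l1norm_ge0 // ltW.
have IzB : I (restr z B) <= e / 2.
  have := Linf_integral_polar zBL zBp; rewrite ler_norml => /andP[_] /le_trans.
  apply; rewrite (_ : L * _ = (L * (C * (K + 1) * fine (p u))) / k); last by field; rewrite gt_eqF.
  rewrite ler_pdivrMr // /k; set X := L * _.
  have -> : e / 2 * (X / (e / 2) + 1) = X + e / 2 by field; rewrite gt_eqF.
  by rewrite lerDl ltW.
apply: rho_le => y yL yu.
(* [y] vanishes off [B] and [z] is kept only there, so the sum stays in the order interval of [u].
   Its integral is at most [rho u], hence at most [I z + e / 2], which leaves
   [I (restr z B) + e / 2] as a bound for [I y]. *)
have : ((I (restr z (~` B) + y))%:E <= rho u)%E.
  apply: rho_ub; first exact: (lin_closedD Ll).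
  move=> j; near=> x; rewrite fctE mxE.
  have yx : `|y x ord0 j| <= `|restr u B x ord0 j| by near: x; exact: yu.
  have zx : `|z x ord0 j| <= `|u x ord0 j| by near: x; exact: zu.
  have [Bx|Bx] := pselect (B x).
    by rewrite restr_out ?mxE ?add0r //; move: yx; rewrite restr_in.
  rewrite restr_in //; move: yx; rewrite restr_out // mxE normr0 normr_le0 => /eqP ->.
  by rewrite addr0.
move=> /le_trans /(_ zI); rewrite lee_fin (linear_onD Ll Il) //.
have : I z = I (restr z B) + I (restr z (~` B)).
  by rewrite -(linear_onD Ll Il) // -restrC.
lra.
Unshelve. all: by end_near. Qed.

(** No constant is lost on the bounded part, since (A3) applies to a restriction of [u] without a
    change of norm; the constant of [integral_fa_bounded] meets only the tail. *)
Lemma integral_fa_le u : U u -> `|integral_fa P N m u| <= L * fine (p u).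
Proof.
move=> uU; have mu := Uspace_meas uU.
have [C C0 hC] := integral_fa_bounded Nnorm mM.
apply: (@le_eps _ _ _ C) => e e0.
have [k hk] := rho_tail uU e0; set B := [set x | k < l1norm (u x)] in hk.
have mB : measurable B by exact: meas_l1norm_gt.
have uBU := restr_Uspace mB uU; have uBCU := restr_Uspace (measurableC mB) uU.
have uBCL : Linf P (restr u (~` B)) by exact: Linf_trunc.
rewrite {1}(restrC u B) (linear_onD Uspace_lin integral_fa_linU) //.
have h1 := hC _ _ (Uspace_dom_rho uBU) e0 hk.
have h2 : `|integral_fa P N m (restr u (~` B))| <= L * fine (p u).
  rewrite integral_fa_Linf //; apply: Linf_integral_polar => //.
  by rewrite -sublinear_fine //; apply: sublinear_restr => //; exact: measurableC.
by apply: le_trans (ler_normD _ _) _; rewrite addrC lerD.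
Qed.

Lemma integral_fa_dual : top_dual P PP (integral_fa P N m).
Proof. exact: top_dual_bound Pp integral_fa_linU integral_fa_le. Qed.

Lemma integral_fa_le_polar u : U u ->
  ((integral_fa P N m u)%:E <= p u * polar P N p m)%E.
Proof.
move=> uU; rewrite pmE sublinear_fine // -EFinM lee_fin mulrC.
exact: le_trans (ler_norm _) (integral_fa_le uU).
Qed.

End polar.

(** * Functionals vanishing on L^oo *)

Lemma annihilator_tail w u : annihilator P PP w -> U u ->
  exists A : nat -> set T, vanishing P A /\
    forall k, U (restr u (A k)) /\ w u = w (restr u (A k)).
Proof.
move=> [[wl _] w0] uU; have mu := Uspace_meas uU.
exists (fun k => [set x | k%:R < l1norm (u x)]); split; first exact: vanishing_gt.
move=> k; have mA : measurable [set x | k%:R < l1norm (u x)] by exact: meas_l1norm_gt.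
have uAU := restr_Uspace mA uU; split=> //.
rewrite {1}(restrC u [set x | k%:R < l1norm (u x)]) (linear_onD Uspace_lin wl) //.
  by rewrite [w (restr u (~` _))]w0 ?addr0 //; exact: Linf_trunc.
by apply: restr_Uspace => //; exact: measurableC.
Qed.

Lemma gen_continuous_vanish f (u_ : nat -> rvec) : linear_on U f ->
  gen_continuous U PP f -> (forall k, U (u_ k)) ->
  (forall p, PP p -> (fun k => p (u_ k)) @ \oo --> 0%E) ->
  f \o u_ @ \oo --> 0.
Proof.
move=> fl fc uU up; have [U0 _] := Uspace_lin.
apply/cvgrPdist_lt => e e0.
have := fc 0 U0 (ball (f 0) e) (nbhsx_ballx _ _ e0).
move=> [F [a [Ff FP a0 hF]]].
have : \forall k \near \oo, forall q, F q -> (q (u_ k) < a%:E)%E.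
  move: FP; have [s ->] := iffLR (finite_seqP F) Ff.
  elim: s => [|q s IH] FP; first by apply: nearW => k q; rewrite /= in_nil.
  have qP : PP q by apply: FP; rewrite /= mem_head.
  have h1 : \forall k \near \oo, forall q', q' \in s -> (q' (u_ k) < a%:E)%E.
    by apply: IH => q' q's; apply: FP; rewrite /= inE q's orbT.
  have h2 : \forall k \near \oo, (q (u_ k) < a%:E)%E.
    have : nbhs (0%E : \bar R) [set y | (y < a%:E)%E].
      by apply: open_ereal_lt'; rewrite lte_fin.
    by move/(up q qP).
  near=> k => q'; rewrite /= inE => /orP[/eqP ->|q's]; first by near: k.
  by move: q' q's; near: k.
apply: filterS => k hk; have /hF : U (u_ k) /\ forall q, F q -> (q (u_ k - 0)%R < a%:E)%E.
  by split=> // q Fq; rewrite subr0; exact: hk.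
by rewrite /= /ball /= (linear_on0 Uspace_lin fl).
Unshelve. all: by end_near. Qed.

(** Under (A5) the tails of [annihilator_tail] tend to 0 in U, while [w] keeps the value [w u] along
    them. *)
Lemma annihilator0 : (forall p, PP p -> A5 P PP p) ->
  forall w, annihilator P PP w <-> forall u, U u -> w u = 0.
Proof.
move=> PP5 w; split=> [wA u uU|w0].
  have [A [vA hA]] := annihilator_tail wA uU; have [[wl wc] _] := wA.
  have : (fun=> w u) @ \oo --> (0 : R).
    rewrite (_ : (fun=> w u) = w \o (fun k => restr u (A k))).
      apply: gen_continuous_vanish => // [k|p Pp]; first by have [] := hA k.
      by have [] := PP5 p Pp u A uU vA.
    by apply/funext => k; have [_ ] := hA k.
  by move/(cvg_lim (@Rhausdorff R)); rewrite lim_cst //; exact: Rhausdorff.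
have Ul := Uspace_lin; split; last by move=> u /Linf_Uspace; exact: w0.
split=> [k u v uU vU|u uU W /nbhs_singleton Wu].
  by rewrite !w0 ?mulr0 ?addr0 //; case: Ul => _; exact.
(* [w] is constant on U, so the neighborhood given by no seminorm at all is small enough. *)
exists set0, 1; split=> // v [vU _] /=.
by rewrite w0 // -(w0 _ uU).
Qed.

End Uspace.

(** * The Yosida-Hewitt decomposition *)

Section yosida_hewitt.
Context {d : measure_display} {T : measurableType d} {R : realType}.
Variables (P : probability T R).
Implicit Types (B C : set T) (A : nat -> set T).

Lemma vanishing_bigcup (D : nat -> set T) : (forall k, measurable (D k)) ->
  (forall k, (P (D k) <= ((1 / 2) ^+ k)%:E)%E) ->
  vanishing P (fun k => \bigcup_i D (i + k)%N).
Proof.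
move=> mD PD.
have mU k : measurable (\bigcup_i D (i + k)%N) by exact: bigcup_measurable.
have sU k : \bigcup_i D (i + k.+1)%N `<=` \bigcup_i D (i + k)%N.
  by move=> x [i _ Dx]; exists i.+1 => //; rewrite addSnnS.
have PU k : (P (\bigcup_i D (i + k)%N) <= (2 * (1 / 2) ^+ k)%:E)%E.
  apply: le_trans (@measure_sigma_subadditive _ _ _ P (\bigcup_i D (i + k)%N)
    (fun i => D (i + k)%N) (fun i => mD (i + k)%N) (mU k) (@subset_refl _ _)) _.
  (* [epsilon_trick0] splits its argument with weights [1 / 2 ^ (i + 1)]; the factor 2 turns the
     i-th share into [(1 / 2) ^ (i + k)]. *)
  have e0 : 0 <= 2 * (1 / 2 : R) ^+ k by rewrite mulr_ge0 // exprn_ge0 //; lra.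
  apply: le_trans (epsilon_trick0 xpredT e0); apply: lee_nneseries => // i _.
  apply: le_trans (PD (i + k)%N) _; rewrite lee_fin natrX exprD !expr_div_n !expr1n exprS.
  rewrite le_eqVlt; apply/orP; left; apply/eqP; field.
  by rewrite !expf_neq0 ?pnatr_eq0.
split=> //; split.
  by apply/nonincreasing_seqP => k; apply: le_measure; rewrite ?inE.
apply: (@squeeze_cvge _ _ _ _ (cst 0%E) _ (fun k => (2 * (1 / 2) ^+ k)%:E)).
- by apply: nearW => k /=; rewrite measure_ge0 PU.
- exact: cvg_cst.
- rewrite (_ : 0%E = (2 * 0 : R)%:E); last by rewrite mulr0.
  apply: cvg_EFin; first exact: nearW.
  by apply: cvgMr; apply: cvg_expr; rewrite ger0_norm; lra.
Qed.

(** * Exhaustion by sets of vanishing probability *)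

Section scalar.
Variable mu : set T -> R.
Hypothesis mua : fin_add mu.
Hypothesis mu0 : forall B, 0 <= mu B.
Hypothesis mum : forall B C, measurable B -> measurable C -> C `<=` B -> mu C <= mu B.

Definition max_mass (e : R) :=
  sup [set mu B | B in [set B | measurable B /\ (P B <= e%:E)%E]].

Lemma max_mass_ub e B : measurable B -> (P B <= e%:E)%E -> mu B <= max_mass e.
Proof.
move=> mB Be; apply: ub_le_sup; last by exists B.
by exists (mu setT) => _ [C [mC _] <-]; exact: mum.
Qed.

Lemma max_mass_adherent e a : 0 <= e -> 0 < a -> exists B,
  [/\ measurable B, (P B <= e%:E)%E & max_mass e - a < mu B].
Proof.
move=> e0 a0; have hs : has_sup [set mu B | B in [set B | measurable B /\ (P B <= e%:E)%E]].
  split; first by exists (mu set0); exists set0 => //; split; rewrite ?measure0 ?lee_fin.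
  by exists (mu setT) => _ [C [mC _] <-]; exact: mum.
by have [_ [B [mB Be] <-] h] := sup_adherent a0 hs; exists B.
Qed.

(* The largest mass that [mu] keeps on sets of vanishing probability. *)
Definition singular_mass := inf [set max_mass e | e in [set e | 0 < e]].

Lemma max_mass_ge0 e : 0 <= e -> 0 <= max_mass e.
Proof.
move=> e0; apply: le_trans (mu0 set0) _; apply: max_mass_ub => //.
by rewrite measure0 lee_fin.
Qed.

Lemma singular_mass_le e : 0 < e -> singular_mass <= max_mass e.
Proof.
move=> e0; apply: ge_inf; last by exists e.
by exists 0 => _ [a a0 <-]; apply: max_mass_ge0; exact: ltW.
Qed.

Lemma singular_mass_adherent a : 0 < a -> exists2 e, 0 < e & max_mass e < singular_mass + a.
Proof.
move=> a0; have hi : has_inf [set max_mass e | e in [set e | 0 < e]].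
  split; first by exists (max_mass 1); exists 1 => //=; exact: ltr01.
  by exists 0 => _ [e e0 <-]; apply: max_mass_ge0; exact: ltW.
by have [_ [e e0 <-] h] := inf_adherent a0 hi; exists e.
Qed.

(** [D k] has probability at most [(1 / 2) ^ k] and nearly the largest mass possible at that size.
    The union of the [D j] with [j >= k] contains every later [D j], whose defect is arbitrarily
    small, so the union loses none of [singular_mass]. *)
Lemma exists_singular_carrier : exists A, vanishing P A /\
  forall k, singular_mass <= mu (A k).
Proof.
have h2 k : 0 < (1 / 2 : R) ^+ k by apply: exprn_gt0; lra.
have /choice[D hD] : forall k, exists B, [/\ measurable B,
    (P B <= ((1 / 2) ^+ k)%:E)%E & max_mass ((1 / 2) ^+ k) - (1 / 2) ^+ k < mu B].
  by move=> k; apply: max_mass_adherent => //; exact: ltW.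
have mD k : measurable (D k) by have [] := hD k.
exists (fun k => \bigcup_i D (i + k)%N); split.
  by apply: vanishing_bigcup => // k; have [] := hD k.
move=> k; apply/ler_addgt0Pr => e e0.
have [i ik] : exists i, (1 / 2 : R) ^+ i < e.
  have : (fun i => (1 / 2 : R) ^+ i) @ \oo --> 0 by apply: cvg_expr; rewrite ger0_norm; lra.
  move/cvgrPdist_lt => /(_ e e0) [i _ /(_ i (leqnn i))] /=.
  by rewrite sub0r normrN gtr0_norm // => ?; exists i.
have ik' : (1 / 2 : R) ^+ (i + k) < e.
  apply: le_lt_trans ik; rewrite exprD ger_pMr // exprn_ile1 //; lra.
have [_ _ h] := hD (i + k)%N.
have h3 := singular_mass_le (h2 (i + k)%N).
have : mu (D (i + k)%N) <= mu (\bigcup_i D (i + k)%N).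
  by apply: mum => //; [exact: bigcup_measurable|move=> x Dx; exists i].
lra.
Qed.

(** If [B] and [A q] are both small, their union has mass below [singular_mass + e], and [A q]
    already takes [singular_mass]. Passing from [k] to a larger [q] only enlarges the difference [B]
    minus [A k], so [A q] may be assumed small. *)
Lemma singular_carrier_rest A : vanishing P A -> (forall k, singular_mass <= mu (A k)) ->
  forall e, 0 < e -> exists2 a : R, 0 < a & forall B, measurable B ->
    (P B <= a%:E)%E -> forall k, mu (B `\` A k) <= e.
Proof.
move=> [mA sA [_ PA]] hA e e0; have [a a0 ha] := singular_mass_adherent e0.
(* One half of [a] for [B], the other for [A q]. *)
exists (a / 2); first by rewrite divr_gt0.
move=> B mB PB k.
have a2 : 0 < a / 2 by rewrite divr_gt0.
have [l _ hl] : \forall l \near \oo, (P (A l) < (a / 2)%:E)%E.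
  have : nbhs (0%E : \bar R) [set y | (y < (a / 2)%:E)%E].
    by apply: open_ereal_lt'; rewrite lte_fin.
  by move/PA.
have sA' i j : (i <= j)%N -> A j `<=` A i.
  by move=> /subnK <-; elim: (j - i)%N => [|q IH] //=; apply: subset_trans IH; exact: sA.
pose q := maxn k l.
have mBA i : measurable (B `\` A i) by exact: measurableD.
apply: (@le_trans _ _ (mu (B `\` A q))).
  apply: mum => // x [Bx Ax]; split=> // Aqx; apply: Ax.
  by apply: (sA' k q) => //; exact: leq_maxl.
have mBAq : measurable (B `|` A q) by exact: measurableU.
have h1 : mu (B `|` A q) = mu (B `\` A q) + mu (A q).
  rewrite (fin_add_split mua mBAq (mA q)) addrC.
  by congr (mu _ + mu _); apply/seteqP; split=> x /=; tauto.
have h2 : mu (B `|` A q) <= max_mass a.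
  apply: max_mass_ub => //; apply: le_trans (measureU2 _ _ _) _ => //.
  rewrite [a]splitr EFinD; apply: leeD => //; apply/ltW; apply: hl.
  by rewrite /= leq_maxr.
by have := hA q; lra.
Qed.

End scalar.

(** By additivity the error of a partial sum is [h] of the remaining part of the union; these parts
    decrease to the empty set, so their probabilities tend to 0. *)
Lemma abs_cont_sigma_additive (h : set T -> R) : fin_add h ->
  (forall e, 0 < e -> exists2 a : R, 0 < a & forall B, measurable B ->
    (P B <= a%:E)%E -> `|h B| <= e) ->
  semi_sigma_additive (fun B => (h B)%:E).
Proof.
move=> ha hc F mF tF mUF.
pose G k := \bigcup_(i in `I_k) F i.
have mG k : measurable (G k) by exact: bigcup_measurable.
have GS k : G k.+1 = G k `|` F k by rewrite /G IIS bigcup_setU bigcup_set1.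
have sumG k : (\sum_(0 <= i < k) (h (F i))%:E)%E = (h (G k))%:E.
  elim: k => [|k IH]; first by rewrite big_geq // /G II0 bigcup_set0 fin_add0.
  rewrite big_nat_recr //= IH GS ha ?EFinD //.
  apply/seteqP; split=> // x [[i /= ik Fi] Fk].
  have := tF i k I I; move=> /(_ (ex_intro _ x (conj Fi Fk))) ik'.
  by rewrite ik' ltnn in ik.
under eq_fun do rewrite sumG.
apply: cvg_EFin; first exact: nearW.
apply/cvgrPdist_le => e e0; have [a a0 ha'] := hc e e0.
pose H k := \bigcup_i F i `\` G k.
have mH k : measurable (H k) by exact: measurableD.
have : P (H k) @[k --> \oo] --> P (\bigcap_k H k).
  apply: nonincreasing_cvg_mu => //.
  - exact: le_lt_trans (probability_le1 _ _) (ltry _).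
  - exact: bigcap_measurable.
  - apply/nonincreasing_seqP => k; apply/subsetPset => x [Fx Gx].
    by split=> // Gkx; apply: Gx; rewrite GS; left.
rewrite (_ : \bigcap_k H k = set0) ?measure0; last first.
  apply/seteqP; split=> // x Hx; have [[i _ Fi] _] := Hx 0%N I.
  by have [_] := Hx i.+1 I; apply; exists i => //=.
have n0 : nbhs (0%E : \bar R) [set y | (y < a%:E)%E].
  by apply: open_ereal_lt'; rewrite lte_fin.
move=> h1; have {}h1 : \forall k \near \oo, (P (H k) < a%:E)%E by exact: (h1 _ n0).
apply: filterS h1 => k /ltW PH.
rewrite (_ : h _ - _ = h (H k)); first exact: ha'.
have GF : G k `<=` \bigcup_i F i by move=> x [i _ Fi]; exists i.
by rewrite /= (fin_add_split ha mUF (mG k)) setIidr // addrAC subrr add0r.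
Qed.

(** * Radon-Nikodym densities *)

Section radon_nikodym.

(* The proofs are arguments so that a charge structure can be attached. *)
Definition charge_of (h : set T -> R) (h0 : h set0 = 0)
  (hs : semi_sigma_additive (fun B => (h B)%:E)) : set T -> \bar R :=
  fun B => (h B)%:E.

Section instance.
Variables (h : set T -> R) (h0 : h set0 = 0).
Variable hs : semi_sigma_additive (fun B => (h B)%:E).

Let charge_of0 : charge_of h0 hs set0 = 0%E.
Proof. by rewrite /charge_of h0. Qed.

Let charge_of_fin B : measurable B -> charge_of h0 hs B \is a fin_num.
Proof. by []. Qed.

HB.instance Definition _ := isCharge.Build _ T R (charge_of h0 hs)
  charge_of0 charge_of_fin hs.

Lemma exists_density : (forall B, measurable B -> P B = 0%E -> h B = 0) ->
  exists g : T -> R, P.-integrable setT (EFin \o g) /\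
    forall B, measurable B -> (h B)%:E = (\int[P]_(x in B) (g x)%:E)%E.
Proof.
move=> hP; have dom : charge_of h0 hs `<< P.
  by apply/null_content_dominatesP => B mB PB; rewrite /charge_of hP.
pose f := Radon_Nikodym (charge_of h0 hs) P.
have fE : f = EFin \o (fine \o f).
  by apply/funext => x /=; rewrite fineK //; exact: Radon_Nikodym_fin_num.
exists (fine \o f); split; first by rewrite -fE; exact: Radon_Nikodym_integrable.
move=> B mB; rewrite -[LHS]/(charge_of h0 hs B) (Radon_Nikodym_integral dom mB).
by rewrite -/f; apply: eq_integral => x _; rewrite {1}fE.
Qed.

End instance.
End radon_nikodym.

Variable n : nat.
Implicit Types m : set T -> 'rV[R]_n.

Lemma yosida_hewitt m : M1 P m -> exists ma ms A,
  [/\ M1 P ma, countably_additive ma, M1 P ms, vanishing P A &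
    (forall k C, measurable C -> C `<=` ~` A k -> ms C = 0) /\
    forall B, measurable B -> m B = ma B + ms B].
Proof.
move=> mM; pose mu := tot_var m.
have mua : fin_add mu := tot_var_add mM.
have mu0 B : 0 <= mu B := tot_var_ge0 mM B.
have mum B C : measurable B -> measurable C -> C `<=` B -> mu C <= mu B.
  exact: (tot_var_mono mM).
have [A [vA hA]] := exists_singular_carrier mu0 mum.
have hac := singular_carrier_rest mua mu0 mum vA hA.
have [mA sA _] := vA.
have sA' i j : (i <= j)%N -> A j `<=` A i.
  by move=> /subnK <-; elim: (j - i)%N => [|q IH] //=; apply: subset_trans IH; exact: sA.
have mD B k : measurable B -> measurable (B `\` A k).
  by move=> mB; apply: measurableD.
have nd (h : set T -> R) : fin_add h -> (forall B, measurable B -> 0 <= h B) ->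
    forall B, measurable B -> cvgn (fun k => h (B `\` A k)).
  move=> ha h0 B mB.
  have hm C D : measurable C -> measurable D -> D `<=` C -> h D <= h C.
    move=> mC mD' DC; rewrite (fin_add_split ha mC mD') setIidr // lerDl h0 //.
    exact: measurableD.
  apply: nondecreasing_is_cvgn.
    apply/nondecreasing_seqP => k; apply: hm; [exact: mD|exact: mD|].
    by move=> x [Bx Ax]; split=> // /sA.
  by exists (h B) => _ [k _ <-]; apply: hm => //; exact: mD.
(* A coordinate of [m] is the difference of its sum with [mu] and of [mu]. Both are nonnegative and
   additive, hence monotone along the increasing sets [B] minus [A k]. *)
have cm B j : measurable B -> cvgn (fun k => m (B `\` A k) ord0 j).
  move=> mB; have ca := fin_addD (M1_add j mM) mua.
  have -> : (fun k => m (B `\` A k) ord0 j) =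
      (fun k => (m (B `\` A k) ord0 j + mu (B `\` A k)) - mu (B `\` A k)).
    by apply/funext => k; rewrite addrK.
  apply: is_cvgB; last exact: nd.
  apply: (nd _ ca) => // C mC; have := le_tot_var mM j mC mC (@subset_refl _ C).
  by rewrite -/mu ler_norml => /andP[]; lra.
pose ma B := \row_j limn (fun k => m (B `\` A k) ord0 j).
have maE B j : measurable B -> m (B `\` A k) ord0 j @[k --> \oo] --> ma B ord0 j.
  by move=> mB; rewrite mxE; exact: cm.
have ma_add j : fin_add (fun B => ma B ord0 j).
  move=> B C mB mC BC; have mBC := measurableU _ _ mB mC.
  have : m ((B `|` C) `\` A k) ord0 j @[k --> \oo] --> ma B ord0 j + ma C ord0 j.
    under eq_fun => k.
      rewrite setDUl (M1_add j mM) //; [over|exact: mD|exact: mD|].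
      by apply: subsetI_eq0 BC => x [].
    by apply: cvgD; exact: maE.
  exact: (cvg_unique _ (maE _ j mBC)).
have ma_le B j K : measurable B -> (forall k, mu (B `\` A k) <= K) ->
    `|ma B ord0 j| <= K.
  move=> mB BK; rewrite mxE ler_norml; apply/andP; split.
    apply: limr_ge; first exact: cm.
    apply: nearW => k; have := le_tot_var mM j (mD B k mB) (mD B k mB) (@subset_refl _ _).
    by have := BK k; rewrite /mu ler_norml => ? /andP[]; lra.
  apply: limr_le; first exact: cm.
  apply: nearW => k; have := le_tot_var mM j (mD B k mB) (mD B k mB) (@subset_refl _ _).
  by have := BK k; rewrite /mu ler_norml => ? /andP[]; lra.
have ma_M1 : M1 P ma.
  split.
  - by move=> j B C mB mC BC; congr EFin; exact: ma_add.
  - exists (mu setT) => B j mB; apply: ma_le => // k; apply: mum => //; exact: mD.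
  move=> B mB PB; apply/matrixP => i j; rewrite ord1 [RHS]mxE.
  apply: (cvg_unique (@Rhausdorff R) (maE _ j mB)) => /=.
  have -> : (fun k => m (B `\` A k) ord0 j) = cst 0; last exact: cvg_cst.
  apply/funext => k; rewrite (M1_null mM mB PB (mD B k mB)) ?mxE //.
pose ms B := m B - ma B.
have msE B j : ms B ord0 j = m B ord0 j - ma B ord0 j.
  by rewrite /ms mxE [X in _ + X]mxE.
have ms_null k C : measurable C -> C `<=` ~` A k -> ms C = 0.
  move=> mC CA; apply/matrixP => i j; rewrite ord1 [RHS]mxE msE.
  apply/eqP; rewrite subr_eq0; apply/eqP.
  apply: (cvg_unique (@Rhausdorff R) _ (maE _ j mC)).
  (* [C] misses [A l] as soon as [l >= k], so the sequence defining [ma C] is eventually equal to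
     [m C]. *)
  apply: cvg_near_cst; exists k => // l kl /=.
  rewrite (_ : C `\` A l = C) //; apply/seteqP; split=> x; first by case.
  by move=> Cx; split=> // /(sA' _ _ kl); exact: CA.
exists ma, ms, A; split=> //.
- move=> j; apply: abs_cont_sigma_additive (ma_add j) _ => e e0.
  have [a a0 ha] := hac e e0; exists a => // B mB PB.
  by apply: ma_le => // k; exact: ha.
- have [Ka Ka0 maK] := M1_bound ma_M1; have [K K0 mK] := M1_bound mM.
  split.
  + move=> j B C mB mC BC; congr EFin; rewrite !msE ma_add // (M1_add j mM) //.
    by rewrite opprD addrACA.
  + exists (K + Ka) => B j mB; rewrite msE; apply: le_trans (ler_normB _ _) _.
    by apply: lerD; [exact: mK|exact: maK].
  + move=> B mB PB; rewrite /ms; case: mM => _ _ ->//; case: ma_M1 => _ _ -> //.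
    by rewrite subrr.
- by split=> // B mB; rewrite /ms addrC subrK.
Qed.

Lemma countably_additive_density m : M1 P m -> countably_additive m ->
  exists y, density P m y.
Proof.
move=> mM mc; have [_ _ mn] := mM.
have /choice[g hg] : forall j, exists g : T -> R, P.-integrable setT (EFin \o g) /\
    forall B, measurable B -> (m B ord0 j)%:E = (\int[P]_(x in B) (g x)%:E)%E.
  move=> j; apply: (exists_density (fin_add0 (M1_add j mM)) (mc j)) => B mB PB.
  by rewrite mn // mxE.
exists (fun x => \row_j g j x); split.
  by apply/L1P => j; under eq_fun do rewrite mxE; have [] := hg j.
by move=> B j mB; under eq_integral do rewrite mxE; have [_ ->] := hg j.
Qed.

End yosida_hewitt.

(** * Densities *)

Section density_pairing.
Context {d : measure_display} {T : measurableType d} {R : realType}.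
Variables (P : probability T R) (n : nat) (N : 'rV[R]_n -> R).
Hypothesis Nnorm : is_norm N.
Local Notation rvec := (T -> 'rV[R]_n).
Implicit Types (u v y : rvec) (m : set T -> 'rV[R]_n).

(** Integrability is asked of each product separately, since the truncation argument of
    [Uspace_pairing] treats one coordinate at a time. *)
Definition pairable y u := meas_rv u /\
  forall j, P.-integrable setT (fun x => (u x ord0 j * y x ord0 j)%:E).

Definition pairing y u : R := fine 'E_P[fun x => dot (u x) (y x)].

Lemma pairing_integrable y u : pairable y u ->
  P.-integrable setT (fun x => (dot (u x) (y x))%:E).
Proof.
move=> [_ h]; rewrite (_ : (fun=> _) =
  (fun x => \sum_(j < n) (u x ord0 j * y x ord0 j)%:E)%E).
  by apply: integrable_sum => // j _.
by apply/funext => x; rewrite sumEFin.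
Qed.

Lemma pairingE y u : pairable y u ->
  ('E_P[fun x => dot (u x) (y x)] = (pairing y u)%:E)%E.
Proof.
move=> h; rewrite /pairing fineK // unlock integrable_fin_num //.
exact: pairing_integrable.
Qed.

Lemma pairable_lin y : lin_closed (pairable y).
Proof.
split; first split.
- by case: (@meas_rv_lin _ T R n).
- move=> j; rewrite (_ : (fun=> _) = cst 0%E); first exact: integrable0.
  by apply/funext => x; rewrite mxE mul0r.
move=> k u v [mu hu] [mv hv]; split; first by case: (@meas_rv_lin _ T R n) => _; exact.
move=> j; rewrite (_ : (fun=> _) = (fun x => k%:E * (u x ord0 j * y x ord0 j)%:E) \+
  (fun x => (v x ord0 j * y x ord0 j)%:E))%E.
  by apply: integrableD => //; exact: integrableZl.
by apply/funext => x; rewrite /= !mxE mulrDl EFinD -mulrA EFinM.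
Qed.

Lemma pairing_lin y : linear_on (pairable y) (pairing y).
Proof.
move=> k u v hu hv; apply: EFin_inj.
have huv : pairable y (k *: u + v) by case: (pairable_lin y) => _; exact.
rewrite -pairingE // EFinD EFinM -!pairingE // unlock.
rewrite -integralZl ?pairing_integrable // -integralD ?pairing_integrable //; last first.
  by apply: integrableZl => //; exact: pairing_integrable.
by apply: eq_integral => x _; rewrite -EFinM -EFinD !fctE dotDl dotZl.
Qed.

Lemma pairable_le y u : L1 P y -> Linf P u -> pairable y u.
Proof.
move=> /L1P yL /LinfP[mu [K uK]]; split=> // j.
have my : measurable_fun [set: T] (fun x => y x ord0 j).
  by have /measurable_int/measurable_EFinP := yL j.
have iK : P.-integrable setT (fun x => K%:E * (y x ord0 j)%:E)%E by exact: integrableZl.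
apply/integrableP; split.
  by apply/measurable_EFinP; apply: measurable_funM => //; exact: mu.
have /integrableP[mK fK] := iK; apply: le_lt_trans fK.
apply: ae_ge0_le_integral => //.
- apply: measurableT_comp => //; apply/measurable_EFinP.
  by apply: measurable_funM => //; exact: mu.
- exact: measurableT_comp.
- apply: filterS uK => x h _; rewrite -EFinM lee_fin !normrM ler_wpM2r //.
  exact: le_trans (coord_le_l1norm _ _) (le_trans h (ler_norm _)).
Qed.

Lemma pairing_le y u (K : R) : L1 P y -> Linf P u -> ae_le P u K ->
  `|pairing y u| <= K * fine (\int[P]_x (l1norm (y x))%:E)%E.
Proof.
move=> yL uL uK; have K0 := ae_le_ge0 uK; have iy := L1_l1norm yL.
have hu := pairable_le yL uL; have iu := pairing_integrable hu.
rewrite -lee_fin EFinM fineK ?integrable_fin_num // -abse_EFin -pairingE // unlock.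
apply: le_trans (le_abse_integral _ _ _) _ => //; first exact: measurable_int iu.
rewrite -integralZl //; apply: ae_ge0_le_integral => //.
- by apply: measurableT_comp => //; exact: measurable_int iu.
- by move=> x _; rewrite mule_ge0 // lee_fin ?l1norm_ge0.
- by apply: measurable_funeM; exact: measurable_int iy.
apply: filterS uK => x uK _; rewrite -EFinM lee_fin /dot mulr_sumr.
apply: le_trans (ler_norm_sum _ _ _) _; apply: ler_sum => j _.
by rewrite normrM ler_wpM2r // (le_trans (coord_le_l1norm _ _)).
Qed.

Lemma pairing_indic m y B (e : 'rV[R]_n) : density P m y -> measurable B ->
  pairing y (fun x => \1_B x *: e) = dot e (m B).
Proof.
move=> [yL yB] mB; apply: EFin_inj.
rewrite -pairingE; last by apply: pairable_le => //; exact: Linf_indic.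
have iyB j : P.-integrable B (fun x => (y x ord0 j)%:E).
  by apply: (integrableS measurableT) => //; exact: (iffLR (L1P P y) yL).
rewrite unlock; under eq_integral do rewrite dotZl.
transitivity (\int[P]_(x in B) (\sum_(j < n) (e ord0 j)%:E * (y x ord0 j)%:E))%E.
  rewrite [RHS]integral_mkcond; apply: eq_integral => x _.
  rewrite patchE indicE; case: ifPn => xB; last by rewrite mul0r.
  by rewrite mul1r /dot -sumEFin; apply: eq_bigr => j _; rewrite EFinM.
rewrite integral_sum //; last by move=> j; exact: integrableZl.
rewrite /dot -sumEFin; apply: eq_bigr => j _.
by rewrite integralZl // -yB.
Qed.

Lemma Linf_integral_density m y : M1 P m -> density P m y ->
  forall v, Linf P v -> Linf_integral P N m v = pairing y v.
Proof.
move=> mM my; have [yL _] := my; apply: Linf_integral_unique => //.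
- by move=> k u v uL vL; apply: pairing_lin; exact: pairable_le.
- exists (fine (\int[P]_x (l1norm (y x))%:E)%E).
    by apply: fine_ge0; apply: integral_ge0 => x _; rewrite lee_fin l1norm_ge0.
  by move=> u K uL uK; rewrite mulrC; exact: pairing_le.
- by move=> B e mB; exact: pairing_indic.
Qed.

(** Absolute continuity of the integral of [l1norm (y x)]. In [exists_decomposition] it makes the
    density part negligible on the carrier of the singular part. *)
Lemma pairing_tail y u A (K : R) : L1 P y -> Linf P u -> ae_le P u K -> vanishing P A ->
  forall e, 0 < e -> exists k, `|pairing y (restr u (A k))| <= K * e.
Proof.
move=> yL uL uK [mA _ [_ PA]] e e0; have K0 := ae_le_ge0 uK; have iy := L1_l1norm yL.
have [a [a0 ha]] := integral_normr_continuous iy e0.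
have [k _ hk] : \forall k \near \oo, (P (A k) < a%:E)%E.
  have : nbhs (0%E : \bar R) [set z | (z < a%:E)%E].
    by apply: open_ereal_lt'; rewrite lte_fin.
  by move/PA.
exists k; have {hk} hk : (P (A k) < a%:E)%E by exact: (hk k (leqnn k)).
have := ha _ (mA k) hk; set J := (\int[P]_(x in A k) _) => Je.
have uAL := Linf_restr (mA k) uL.
have hu := pairable_le yL uAL; have iu := pairing_integrable hu.
have iyA : P.-integrable (A k) (fun x => (l1norm (y x))%:E).
  exact: integrableS iy.
apply: (@le_trans _ _ (K * J)); last by rewrite ler_wpM2l // ltW.
rewrite -lee_fin EFinM /J.
rewrite fineK; last by apply: integrable_fin_num => //; exact: integrable_abse iyA.
rewrite -abse_EFin -pairingE // unlock.
apply: le_trans (le_abse_integral _ _ _) _ => //; first exact: measurable_int iu.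
rewrite -integralZl //; last exact: integrable_abse iyA.
rewrite [leRHS]integral_mkcond; apply: ae_ge0_le_integral => //.
- by apply: measurableT_comp => //; exact: measurable_int iu.
- by move=> x _; rewrite erestrict_ge0 // => z _; rewrite mule_ge0 // lee_fin.
- apply: (iffLR (measurable_restrictT _ (mA k))); apply: measurable_funeM.
  exact: measurable_int (integrable_abse iyA).
apply: filterS uK => x uK _; rewrite patchE.
case: ifPn => [|]; rewrite ?inE => xA; last first.
  by rewrite restr_out ?dot0l ?abse0 // => h; move: xA; rewrite notin_setE; apply.
rewrite restr_in //.
rewrite [X in (_ * X%:E)%E]ger0_norm ?l1norm_ge0 // -EFinM abse_EFin lee_fin mulrC.
rewrite /dot /l1norm mulr_suml; apply: le_trans (ler_norm_sum _ _ _) _; apply: ler_sum => j _.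
by rewrite normrM [leRHS]mulrC; apply: ler_wpM2r => //; apply: le_trans uK; exact: coord_le_l1norm.
Qed.

End density_pairing.

(** * Finiteness of the expectation on U *)

Section Uspace_pairing.
Context {d : measure_display} {T : measurableType d} {R : realType}.
Variables (P : probability T R) (n : nat) (N : 'rV[R]_n -> R).
Local Notation rvec := (T -> 'rV[R]_n).
Variable PP : set (rvec -> \bar R).
Hypothesis Nnorm : is_norm N.
Hypothesis PPsub : forall p, PP p -> sublinear_symmetric P p.
Hypothesis PP2 : forall p, PP p -> A2 P N p.
Hypothesis PP3 : forall p, PP p -> A3 P N PP p.
Local Notation U := (Uspace P PP).

(** On L^oo the pairing is the integral against [m], which the polar controls. Applied to [v k], the
    truncated [|u_j|] times the sign of [y_j], this bounds the integral of [a k x * |y_j|]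
    independently of [k]; its monotone limit is the integral of [|u_j * y_j|]. *)
Lemma Uspace_pairing p m y : PP p -> M1 P m -> (polar P N p m < +oo)%E ->
  density P m y -> exists2 C : R, 0 <= C &
  forall u, U u -> pairable P y u /\ `|pairing P y u| <= C * fine (p u).
Proof.
move=> Pp mM pm my; have [yL yB] := my.
have [C C0 hC] := sublinear_dom Nnorm PPsub PP3.
pose L := fine (polar P N p m).
have L0 : 0 <= L by rewrite fine_ge0 // (polar_ge0 Nnorm PPsub Pp mM).
have mY := L1_meas yL.
have key u j : U u -> (\int[P]_x `|(u x ord0 j * y x ord0 j)%:E| <= (L * C * fine (p u))%:E)%E.
  move=> uU; have mu := Uspace_meas uU.
  pose a k x : R := Num.min `|u x ord0 j| k%:R.
  have mna : measurable_fun [set: T] (fun x => `|u x ord0 j|).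
    by apply: measurableT_comp => //; exact: mu.
  have ma k : measurable_fun [set: T] (a k) by apply: measurable_minr.
  have a0 k x : 0 <= a k x by rewrite le_min normr_ge0 ler0n.
  pose B := [set x | 0 <= y x ord0 j].
  have mB : measurable B.
    rewrite -[X in measurable X]setTI.
    exact: (measurable_fun_ler (measurable_cst _) (mY j)).
  (* A measurable sign that is 1 where [y] vanishes, so that its absolute value is 1 everywhere. *)
  pose sg x : R := 2 * \1_B x - 1.
  have sgy x : `|sg x| = 1 /\ sg x * y x ord0 j = `|y x ord0 j|.
    rewrite /sg indicE; case: (leP 0 (y x ord0 j)) => yx.
      rewrite mem_set // mulr1 [2 - 1](_ : _ = 1); last by ring.
      by rewrite normr1 mul1r ger0_norm.
    rewrite memNset; last by rewrite /B /= leNgt yx.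
    by rewrite mulr0 sub0r normrN1 mulN1r ltr0_norm.
  pose v k : rvec := fun x => (sg x * a k x) *: delta_mx ord0 j.
  have ms : measurable_fun [set: T] sg.
    by apply: measurable_funB => //; apply: measurable_funM.
  have l1v k x : l1norm (v k x) = a k x.
    by rewrite l1norm_delta normrM (ger0_norm (a0 k x)) (proj1 (sgy x)) mul1r.
  have vL k : Linf P (v k).
    apply/LinfP; split.
      move=> i; rewrite (_ : (fun=> _) =
        (fun x => sg x * a k x * (delta_mx ord0 j : 'rV[R]_n) ord0 i)).
        by apply: measurable_funM => //; exact: measurable_funM.
      by apply/funext => x; rewrite mxE.
    exists k%:R; apply: nearW => x.
    by rewrite l1v ge_min lexx orbT.
  have pv k : (p (v k) <= (C * 1 * fine (p u))%:E)%E.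
    apply: hC => //; first exact: Linf_meas (vL k).
    apply: nearW => x; rewrite mul1r.
    by rewrite l1v ge_min coord_le_l1norm.
  have Iv k : (\int[P]_x (a k x * `|y x ord0 j|)%:E <= (L * C * fine (p u))%:E)%E.
    have := Linf_integral_polar Nnorm PPsub Pp mM pm (vL k) (pv k).
    rewrite (Linf_integral_density Nnorm mM my (vL k)) mulr1 mulrA => /(le_trans (ler_norm _)).
    rewrite -lee_fin -pairingE; last exact: pairable_le.
    rewrite unlock; congr (_ <= _)%E; apply: eq_integral => x _.
    by rewrite /v dotZl dot_deltal mulrAC (proj2 (sgy x)) mulrC.
  have mono x : nondecreasing_seq (fun k => (a k x * `|y x ord0 j|)%:E).
    apply/nondecreasing_seqP => k; rewrite lee_fin ler_wpM2r //.
    by rewrite le_min !ge_min lexx /= ler_nat leqnSn orbT.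
  have mg k : measurable_fun [set: T] (fun x => (a k x * `|y x ord0 j|)%:E).
    apply/measurable_EFinP; apply: measurable_funM => //.
    by apply: measurableT_comp => //; exact: mY.
  have mc := @monotone_convergence _ _ _ P setT measurableT
    (fun k x => (a k x * `|y x ord0 j|)%:E) mg _ _.
  rewrite (eq_integral (fun x => limn (fun k => (a k x * `|y x ord0 j|)%:E))); last first.
    move=> x _; apply/esym/cvg_lim => //; apply: cvg_near_cst.
    exists (Num.truncn `|u x ord0 j|).+1 => // k /= kx.
    rewrite /a min_l ?normrM // ltW //; apply: lt_le_trans (truncnS_gt _) _.
    by rewrite ler_nat.
  rewrite mc; [|by move=> k x _; rewrite lee_fin mulr_ge0|by move=> x _; exact: mono].
  apply: lime_le; last exact: nearW.
  apply: ereal_nondecreasing_is_cvgn => k l kl; apply: ge0_le_integral => //.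
  - by move=> x _; rewrite lee_fin mulr_ge0.
  - by move=> x _; exact: mono.
have pu u : U u -> pairable P y u.
  move=> uU; split=> [|j]; first exact: Uspace_meas uU.
  apply/integrableP; split; last exact: le_lt_trans (key u j uU) (ltry _).
  apply/measurable_EFinP; apply: measurable_funM; last exact: mY.
  exact: Uspace_meas uU j.
exists (n%:R * (L * C)); first by rewrite !mulr_ge0 // ltW.
move=> u uU; split; first exact: pu.
have iu := pairing_integrable (pu u uU); have [_ iuj] := pu u uU.
rewrite -lee_fin -abse_EFin -pairingE ?unlock; last exact: pu.
apply: le_trans (le_abse_integral _ _ _) _ => //; first exact: measurable_int iu.
apply: (@le_trans _ _ (\int[P]_x (\sum_(j < n) `|(u x ord0 j * y x ord0 j)%:E|))%E).
  apply: ge0_le_integral => //.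
  - by apply: measurableT_comp => //; exact: measurable_int iu.
  - by apply: emeasurable_sum => j; apply: measurableT_comp => //; exact: measurable_int (iuj j).
  - by move=> x _; rewrite sumEFin lee_fin; exact: ler_norm_sum.
rewrite ge0_integral_sum //; last first.
  by move=> j; apply: measurableT_comp => //; exact: measurable_int (iuj j).
apply: (@le_trans _ _ (\sum_(j < n) (L * C * fine (p u))%:E)%E).
  by apply: lee_sum => j _; exact: key.
have -> : n%:R * (L * C) * fine (p u) = (L * C * fine (p u)) *+ n.
  by rewrite -[RHS]mulr_natl !mulrA.
by rewrite sumEFin lee_fin sumr_const card_ord.
Qed.

End Uspace_pairing.

Lemma sup_eq0 {R : realType} (S : set R) :
  S !=set0 -> (forall x, S x -> x = 0) -> sup S = 0.
Proof.
move=> [a Sa] S0; rewrite (_ : S = [set 0]) ?sup1 //.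
by apply/seteqP; split=> [x /S0 //|x ->]; rewrite -(S0 _ Sa).
Qed.

(** * The dual of U *)

Section null_measures.
Context {d : measure_display} {T : measurableType d} {R : realType}.
Variables (P : probability T R) (n : nat) (N : 'rV[R]_n -> R).
Hypothesis Nnorm : is_norm N.
Local Notation rvec := (T -> 'rV[R]_n).
Implicit Types (u v : rvec) (m : set T -> 'rV[R]_n) (B C : set T).

Lemma dual_norm_eq0 (b : 'rV[R]_n) : dual_norm N b = 0 -> b = 0.
Proof.
move=> b0; have [_ NZ _] := Nnorm; have [c c0 hc] := l1norm_le_norm Nnorm.
(* For an unbounded set [sup] would take its default value 0 and the hypothesis would say nothing
   about [b]. *)
have hub : has_ubound [set dot a b | a in [set a | N a <= 1]].
  exists (c * l1norm b) => _ [a /= a1 <-]; apply: le_trans (ler_norm _) _.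
  apply: le_trans (dot_le (M := l1norm b) _ _) _ => [j|]; first exact: coord_le_l1norm.
  rewrite ler_wpM2r ?l1norm_ge0 //; apply: le_trans (hc a) _.
  by rewrite ger_pMr.
have dot_le0 a : dot a b <= 0.
  (* A scaling of [a] into the unit ball of [N] that also works for [N a = 0]. *)
  pose t := (N a + 1)^-1; have Na := norm_ge0 Nnorm a.
  have t0 : 0 < t by rewrite invr_gt0 ltr_wpDl.
  have : dot (t *: a) b <= 0.
    rewrite -b0; apply: ub_le_sup => //; exists (t *: a) => //=.
    by rewrite NZ gtr0_norm // mulrC ler_pdivrMr ?ltr_wpDl // mul1r lerDl.
  by rewrite dotZl pmulr_rle0.
apply/matrixP => i j; rewrite ord1 mxE; apply/eqP; rewrite eq_le.
have := dot_le0 (delta_mx ord0 j); have := dot_le0 (- 1 *: delta_mx ord0 j).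
by rewrite dotZl dot_deltal; lra.
Qed.

(** A dual norm vanishes only at 0, and both Jordan parts are nonnegative, so each of them vanishes.
    The norm condition in [M1s] thereby becomes vanishing on measurable subsets, the form in which
    it is used. *)
Lemma abs_dual_eq0 m B : M1 P m ->
  abs_dual N m B = 0 <-> forall C, measurable C -> C `<=` B -> m C = 0.
Proof.
move=> mM; have [K K0 mK] := M1_bound mM.
have negE j : neg_part m B ord0 j = pos_var (fun C => - m C ord0 j) B.
  rewrite mxE; congr sup; apply/seteqP.
  by split=> _ [C CB <-]; exists C => //; rewrite mxE.
have posE j : pos_part m B ord0 j = pos_var (fun C => m C ord0 j) B by rewrite mxE.
split=> [/dual_norm_eq0 h C mC CB|h].
  apply/matrixP => i j; rewrite ord1 [RHS]mxE.
  have /matrixP /(_ ord0 j) := h; rewrite mxE posE negE [RHS]mxE.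
  have h1 : m C ord0 j <= pos_var (fun C => m C ord0 j) B.
    apply: (@pos_var_ub _ _ _ _ K) => // E mE; exact: le_trans (ler_norm _) (mK E j mE).
  have h2 : - m C ord0 j <= pos_var (fun C => - m C ord0 j) B.
    apply: (@pos_var_ub _ _ _ (fun C => - m C ord0 j) K) => // E mE.
    by rewrite lerNl; have := mK E j mE; rewrite ler_norml => /andP[].
  have h3 : 0 <= pos_var (fun C => m C ord0 j) B.
    apply: (@pos_var_ge0 _ _ _ _ K) (M1_add j mM) _ => E mE.
    exact: le_trans (ler_norm _) (mK E j mE).
  have h4 : 0 <= pos_var (fun C => - m C ord0 j) B.
    apply: (@pos_var_ge0 _ _ _ _ K) (fin_addN (M1_add j mM)) _ => E mE.
    by rewrite lerNl; have := mK E j mE; rewrite ler_norml => /andP[].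
  lra.
have E0 : pos_part m B + neg_part m B = 0.
  apply/matrixP => i j; rewrite ord1 mxE posE negE [RHS]mxE /pos_var !sup_eq0 ?addr0 //.
  - by exists (- m set0 ord0 j); exists set0 => //; split.
  - by move=> _ [C [mC CB] <-]; rewrite h // mxE oppr0.
  - by exists (m set0 ord0 j); exists set0 => //; split.
  - by move=> _ [C [mC CB] <-]; rewrite h // mxE.
rewrite /abs_dual E0 /dual_norm sup_eq0 //.
  by exists (dot (0 : 'rV[R]_n) 0); exists 0 => //=; rewrite (norm_0 Nnorm).
by move=> _ [a _ <-]; exact: dot0r.
Qed.

Lemma Linf_integral_null m C : M1 P m -> measurable C ->
  (forall B, measurable B -> B `<=` C -> m B = 0) ->
  forall v, Linf P v -> Linf_integral P N m (restr v C) = 0.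
Proof.
move=> mM mC m0; have Il := Linf_integral_lin Nnorm mM.
have [K K0 Ib] := Linf_integral_bounded Nnorm mM.
apply: (@Linf_ext _ _ _ P n (fun v => Linf_integral P N m (restr v C)) (fun=> 0)).
- by move=> k u v uL vL; rewrite restr_lin Il //; exact: Linf_restr.
- exists K => // u L uL uK; apply: Ib; first exact: Linf_restr.
  exact: ae_le_restr.
- by move=> k u v _ _; rewrite mulr0 addr0.
- by exists 0 => // u L _ _; rewrite normr0 mul0r.
move=> B e mB; rewrite (_ : restr _ C = (fun x => \1_(B `&` C) x *: e)).
  rewrite Linf_integral_indic ?m0 ?dot0r //; exact: measurableI.
by apply/funext => x; rewrite /restr scalerA indicI mulrC.
Qed.

End null_measures.

(** * Decomposition of continuous functionals on U *)

Section duality.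
Context {d : measure_display} {T : measurableType d} {R : realType}.
Variables (P : probability T R) (n : nat) (N : 'rV[R]_n -> R).
Local Notation rvec := (T -> 'rV[R]_n).
Variable PP : set (rvec -> \bar R).
Hypothesis n0 : (0 < n)%N.
Hypothesis Nnorm : is_norm N.
Hypothesis PPsub : forall p, PP p -> sublinear_symmetric P p.
Hypothesis PP1 : A1 P N PP.
Hypothesis PP2 : forall p, PP p -> A2 P N p.
Hypothesis PP3 : forall p, PP p -> A3 P N PP p.
Local Notation U := (Uspace P PP).
Implicit Types (u v y : rvec) (f w : rvec -> R) (p : rvec -> \bar R).
Implicit Types (m : set T -> 'rV[R]_n).
Let Ul := Uspace_lin PPsub.
Let Ll := Linf_lin P n.
Let LU v (vL : Linf P v) : U v := Linf_Uspace Nnorm PP2 vL.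

Lemma Yspace_pairing y : Yspace P N PP y ->
  (forall u, U u -> pairable P y u) /\ top_dual P PP (pairing P y).
Proof.
move=> [m [[mM [p [Pp pm]]] _ my]].
have [C C0 h] := Uspace_pairing Nnorm PPsub PP3 Pp mM pm my.
split=> [u uU|]; first by have [] := h u uU.
apply: (top_dual_bound PPsub Pp (L := C)) => [k u v uU vU|u uU].
  by apply: pairing_lin; [have [] := h u uU|have [] := h v vU].
by have [] := h u uU.
Qed.

Lemma Mspace_dual m : Mspace P N PP m -> top_dual P PP (integral_fa P N m).
Proof. by move=> [mM [p [Pp pm]]]; exact: (integral_fa_dual Nnorm PPsub PP3 Pp mM pm). Qed.

Lemma dual_of_triple y m w :
  Yspace P N PP y -> Ms P N PP m -> annihilator P PP w ->
  exists2 f, top_dual P PP f & represents P N PP y m w f.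
Proof.
move=> yY [mM _] [wD _]; have [py yD] := Yspace_pairing yY.
(* The factors 1 give the sum the shape expected by [top_dual_comb]. *)
exists (fun u => 1 * (1 * pairing P y u + integral_fa P N m u) + w u).
  by do 2 (apply: top_dual_comb => //); exact: Mspace_dual.
by move=> u uU; rewrite !mul1r !EFinD pairingE //; exact: py.
Qed.

Lemma representsE f y m w : Yspace P N PP y -> represents P N PP y m w f ->
  forall u, U u -> f u = pairing P y u + integral_fa P N m u + w u.
Proof.
move=> yY fE u uU; have [py _] := Yspace_pairing yY.
by apply: EFin_inj; rewrite fE // pairingE ?EFinD //; exact: py.
Qed.

Lemma Mspace_M1 m : Mspace P N PP m -> M1 P m. Proof. by case. Qed.

(** Testing on indicators gives [ma + m = ma' + m']. Off [D k] both singular measures vanish, so the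
    densities agree there, hence almost surely because the [D k] shrink to a null set. Equality of
    the singular measures, and then of [w] and [w'] on U, follows by subtraction. *)
Lemma decomposition_unique f y m w y' m' w' :
  Yspace P N PP y -> Ms P N PP m -> annihilator P PP w ->
  represents P N PP y m w f ->
  Yspace P N PP y' -> Ms P N PP m' -> annihilator P PP w' ->
  represents P N PP y' m' w' f ->
  [/\ \forall x \ae P, y x = y' x, forall B, measurable B -> m B = m' B
    & forall u, U u -> w u = w' u].
Proof.
move=> yY [mM [_ [A [vA mA]]]] [_ w0] fE y'Y [m'M [_ [A' [vA' m'A]]]] [_ w'0] f'E.
have [M1m M1m'] := (Mspace_M1 mM, Mspace_M1 m'M).
have [ma [maM _ may]] := yY; have [ma' [ma'M _ ma'y]] := y'Y.
have [yL yB] := may; have [y'L y'B] := ma'y.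
have key B (e : 'rV[R]_n) : measurable B ->
    dot e (ma B) + dot e (m B) = dot e (ma' B) + dot e (m' B).
  move=> mB; have eL := Linf_indic P e mB; have eU := LU eL.
  have := representsE yY fE eU; rewrite (representsE y'Y f'E eU) w0 // w'0 // !addr0.
  rewrite !integral_fa_Linf // !Linf_integral_indic //.
  by rewrite (pairing_indic _ may mB) (pairing_indic _ ma'y mB).
have keyB B : measurable B -> ma B + m B = ma' B + m' B.
  move=> mB; apply/matrixP => i j; rewrite ord1.
  by have := key B (delta_mx ord0 j) mB; rewrite !dot_deltal !mxE.
have [mAk sA [nA A0]] := vA; have [mAk' sA' [nA' A0']] := vA'.
pose D k := A k `|` A' k.
have mD k : measurable (D k) by exact: measurableU.
have off k B : measurable B -> B `<=` ~` D k -> ma B = ma' B.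
  move=> mB BD; have := keyB B mB.
  have -> : m B = 0.
    apply: (iffLR (abs_dual_eq0 Nnorm _ M1m) (mA k)) => // x /BD h Ax; apply: h; by left.
  have -> : m' B = 0; last by rewrite !addr0.
  by apply: (iffLR (abs_dual_eq0 Nnorm _ M1m') (m'A k)) => // x /BD h Ax; apply: h; right.
have yE j : ae_eq P setT (fun x => (y x ord0 j)%:E) (fun x => (y' x ord0 j)%:E).
  have iy := iffLR (L1P P y) yL j; have iy' := iffLR (L1P P y') y'L j.
  have offE k : ae_eq P (~` D k) (fun x => (y x ord0 j)%:E) (fun x => (y' x ord0 j)%:E).
    apply: integral_ae_eq; first exact: measurableC.
    - by apply: integrableS iy => //; exact: measurableC.
    - by apply: measurable_funS (measurable_int _ iy').
    - by move=> E ED mE; rewrite -yB // -y'B // (off k).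
  have h : \forall x \ae P, forall k, (~` D k) x -> (y x ord0 j)%:E = (y' x ord0 j)%:E.
    by apply/ae_foralln => k; exact: offE.
  have D0 : P (\bigcap_k D k) = 0%E.
    have mDI : measurable (\bigcap_k D k) by exact: bigcap_measurable.
    apply/eqP; rewrite -measure_le0.
    have cD : (fun k => P (A k) + P (A' k))%E @ \oo --> (0 + 0)%E by exact: cvgeD.
    rewrite add0e in cD; rewrite -(cvg_lim _ cD) //; apply: lime_ge.
      by apply/cvg_ex; exists 0%E.
    apply: nearW => k; apply: le_trans (measureU2 _ (mAk k) (mAk' k)).
    apply: le_measure; rewrite ?inE //; first exact: (mD k).
    by move=> x; apply.
  have h2 : \forall x \ae P, exists k, (~` D k) x.
    exists (\bigcap_k D k); split=> //; first exact: bigcap_measurable.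
    by move=> x /forallNP h2 k _; exact: contrapT (h2 k).
  by apply: filterS2 h h2 => x h [k Dx] _; exact: h Dx.
have yy' : \forall x \ae P, y x = y' x.
  have : \forall x \ae P, forall j, y x ord0 j = y' x ord0 j.
    by apply: ae_forall_ord => j; apply: filterS (yE j) => x /(_ I) [].
  by apply: filterS => x h; apply/matrixP => i j; rewrite ord1.
have mama' B : measurable B -> ma B = ma' B.
  move=> mB; apply/matrixP => i j; rewrite ord1; apply: EFin_inj; rewrite yB // y'B //.
  have iy := iffLR (L1P P y) yL j; have iy' := iffLR (L1P P y') y'L j.
  apply: ae_eq_integral => //.
  - by apply: measurable_funS (measurable_int _ iy).
  - by apply: measurable_funS (measurable_int _ iy').
  - by apply: filterS (yE j) => x h _; exact: h.
have mm' B : measurable B -> m B = m' B.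
  by move=> mB; have := keyB B mB; rewrite mama' // => /addrI.
split=> // u uU; have := representsE yY fE uU; rewrite (representsE y'Y f'E uU).
rewrite (proj2 (integral_fa_eq P N mm')).
suff -> : pairing P y u = pairing P y' u by move/addrI.
have [py _] := Yspace_pairing yY; have [py' _] := Yspace_pairing y'Y.
rewrite /pairing unlock; congr fine; apply: ae_eq_integral => //.
- exact: measurable_int (pairing_integrable (py u uU)).
- exact: measurable_int (pairing_integrable (py' u uU)).
- by apply: filterS yy' => x ->.
Qed.

(** A singular [m] sees an indicator only through its restriction to [A k]; the polar bounds that
    integral by a multiple of [p] of the restriction, which (A4) sends to 0. *)
Lemma Ms_eq0 : (forall p, PP p -> A4 P p) ->
  forall m, Ms P N PP m <-> forall B, measurable B -> m B = 0.
Proof.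
move=> PP4 m; split=> [[[mM [p [Pp pm]]] [_ [A [vA mA]]]] B mB|m0].
  have [mAk _ _] := vA.
  apply/matrixP => i j; rewrite ord1 [RHS]mxE.
  pose e : rvec := fun x => \1_B x *: delta_mx ord0 j.
  have eL : Linf P e by exact: Linf_indic.
  have Ie k : m B ord0 j = Linf_integral P N m (restr e (A k)).
    have eAL := Linf_restr (mAk k) eL; have eCL := Linf_restr (measurableC (mAk k)) eL.
    rewrite -(dot_deltal j (m B)) -(Linf_integral_indic Nnorm _ mM mB) -/e.
    rewrite {1}(restrC e (A k)) (linear_onD Ll (Linf_integral_lin Nnorm mM)) //.
    rewrite [X in _ + X](Linf_integral_null Nnorm mM (measurableC (mAk k))) ?addr0 //.
    exact: (iffLR (abs_dual_eq0 Nnorm _ mM) (mA k)).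
  have [_ pA] := PP4 p Pp e A eL vA.
  apply: (@eq0_le_eps _ _ (fine (polar P N p m))) => a a0.
  have [k _ hk] : \forall k \near \oo, (p (restr e (A k)) < a%:E)%E.
    have : nbhs (0%E : \bar R) [set z | (z < a%:E)%E].
      by apply: open_ereal_lt'; rewrite lte_fin.
    by move/pA.
  rewrite (Ie k); apply: (Linf_integral_polar Nnorm PPsub Pp mM pm).
    exact: Linf_restr.
  by apply/ltW/(hk k (leqnn k)).
have mM : M1 P m.
  split=> [j B C mB mC BC||B mB _]; last exact: m0.
    by rewrite !m0 ?mxE ?adde0 //; exact: measurableU.
  by exists 0 => B j mB; rewrite m0 // mxE normr0.
split; split=> //.
  (* Even the zero measure needs some element of PP in order to belong to M. *)
  have [p Pp] := PP_nonempty n0 Nnorm PPsub PP1 PP2; exists p; split=> //.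
  apply: (@le_lt_trans _ _ 0%E); last exact: ltry.
  apply: (polar_le Nnorm PPsub PP2 Pp) => // v vL; rewrite mul0r.
  have -> : v = restr v setT by apply/funext => x; rewrite restr_in.
  by rewrite (Linf_integral_null Nnorm mM measurableT) // => B mB _; exact: m0.
exists (fun=> set0); split.
  split=> [k|k|]; [exact: measurable0|by []|split=> [k l _ //|]].
  by rewrite measure0; exact: cvg_cst.
by move=> k; apply: (iffRL (abs_dual_eq0 Nnorm _ mM)) => C mC _; exact: m0.
Qed.

Lemma directed_finite (s : seq (rvec -> \bar R)) : directed P PP ->
  (forall q, q \in s -> PP q) -> exists r, PP r /\ exists2 C : R, 0 < C &
    forall q u, q \in s -> U u -> fine (q u) <= C * fine (r u).
Proof.
move=> dir; elim: s => [|q s IH] sP.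
  (* A neighborhood may involve no seminorm; any element of PP then serves. *)
  have [p Pp] := PP_nonempty n0 Nnorm PPsub PP1 PP2.
  by exists p; split=> //; exists 1.
have Pq : PP q by apply: sP; rewrite mem_head.
have [r [Pr [C C0 hC]]] : exists r, PP r /\ exists2 C : R, 0 < C &
    forall q u, q \in s -> U u -> fine (q u) <= C * fine (r u).
  by apply: IH => q' q's; apply: sP; rewrite inE q's orbT.
have [r' [Pr' [c hc]]] := dir q r Pq Pr.
have c1 : 0 < `|c| + 1 by rewrite ltr_wpDl.
(* [C] serves the elements of [s] through [r], and 1 serves [q]; [|c| + 1] replaces a [c] that may
   be negative. *)
exists r'; split=> //; exists ((C + 1) * (`|c| + 1)).
  by rewrite mulr_gt0 // addr_gt0.
move=> q' u; rewrite inE => q's uU; have [] := hc u uU.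
rewrite (sublinear_fine PPsub Pq uU) (sublinear_fine PPsub Pr uU).
rewrite (sublinear_fine PPsub Pr' uU) -EFinM !lee_fin /= => h1 h2.
have r'0 := fine_sublinear_ge0 PPsub Pr' uU.
have cr : c * fine (r' u) <= (`|c| + 1) * fine (r' u).
  by rewrite ler_wpM2r //; have := ler_norm c; lra.
have cr0 : 0 <= (`|c| + 1) * fine (r' u) by rewrite mulr_ge0 // ltW.
rewrite -mulrA mulrDl mul1r; case/orP: q's => [/eqP ->|q's].
  by apply: le_trans h1 _; apply: le_trans cr _; rewrite lerDr mulr_ge0 // ltW.
apply: le_trans (hC _ _ q's uU) _.
have : C * fine (r u) <= C * ((`|c| + 1) * fine (r' u)).
  by rewrite ler_wpM2l ?(ltW C0) // (le_trans h2).
lra.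
Qed.

Lemma top_dual_dominated f : directed P PP -> top_dual P PP f ->
  exists r, PP r /\ exists2 L : R, 0 <= L & forall u, U u -> `|f u| <= L * fine (r u).
Proof.
move=> dir [fl fc]; have [F [e [Ff FP e0 hF]]] := gen_continuous_at0 Ul fl fc.
have [s sE] := iffLR (finite_seqP F) Ff.
have sP q : q \in s -> PP q by move=> qs; apply: FP; rewrite sE.
have [r [Pr [C C0 hC]]] := directed_finite dir sP.
exists r; split=> //; exists (2 / e * C); first by rewrite mulr_ge0 ?divr_ge0 // ltW.
move=> u uU; rewrite -(mulrA (2 / e)); have r0 := fine_sublinear_ge0 PPsub Pr uU.
apply: scaling_bound => //; first by rewrite mulr_ge0 // ltW.
move=> t t0 h; rewrite -(gtr0_norm t0) -normrM -(linear_onZ t Ul fl uU).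
have tU : U (t *: u) := lin_closedZ t Ul uU.
apply: hF => // q; rewrite sE /= => qs.
have qu : (q u <= (fine (q u))%:E)%E.
  by rewrite -(sublinear_fine PPsub (sP _ qs) uU).
have := sublinearZ_le PPsub t (sP _ qs) (Uspace_L1 uU) qu.
move/le_lt_trans; apply; rewrite lte_fin gtr0_norm //; apply: le_lt_trans h.
by rewrite ler_pM2l // hC.
Qed.

Section restriction.
Variables (f : rvec -> R) (r : rvec -> \bar R) (L : R).
Hypothesis fl : linear_on U f.
Hypothesis Pr : PP r.
Hypothesis L0 : 0 <= L.
Hypothesis fr : forall u, U u -> `|f u| <= L * fine (r u).

Definition measure_of (B : set T) : 'rV[R]_n :=
  \row_j f (fun x => \1_B x *: delta_mx ord0 j).

Let f_linear : linear_on (Linf P (n := n)) f.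
Proof. by move=> k u v uL vL; apply: fl; exact: LU. Qed.

Let f_bounded : Linf_bounded P f.
Proof.
have [c c0 hc] := sublinear_Linf Nnorm PP2 Pr.
exists (L * c); first by rewrite mulr_ge0.
move=> u K uL uK; apply: le_trans (fr (LU uL)) _; rewrite -mulrA ler_wpM2l //.
by have := hc u K uL uK; rewrite (sublinear_fine PPsub Pr (LU uL)) lee_fin.
Qed.

Lemma measure_of_M1 : M1 P measure_of.
Proof.
have [C C0 fb] := f_bounded.
split=> [j B E mB mE BE||B mB PB].
- rewrite -EFinD !mxE; congr EFin.
  rewrite -(linear_onD Ll f_linear); [|exact: Linf_indic|exact: Linf_indic].
  congr f; apply/funext => x; rewrite fctE -scalerDl; congr (_ *: _).
  rewrite !indicE in_setU; have [xB|xB] := boolP (x \in B); last by rewrite add0r.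
  have [xE|xE] := boolP (x \in E); last by rewrite addr0.
  have : (B `&` E) x by split; rewrite -in_setE.
  by rewrite BE.
- exists (C * 1) => B j mB; rewrite mxE; apply: fb; first exact: Linf_indic.
  apply: nearW => x; rewrite l1norm_delta indicE.
  by case: (x \in B); rewrite ?normr1 ?normr0.
apply/matrixP => i j; rewrite ord1 !mxE; apply/eqP; rewrite -normr_le0 -(mulr0 C).
apply: fb; first exact: Linf_indic.
exists B; split=> // x /=; apply: contra_notP => Bx.
by rewrite indicE memNset // scale0r l1norm0.
Qed.

Lemma Linf_integral_measure_of v : Linf P v ->
  Linf_integral P N measure_of v = f v.
Proof.
apply: Linf_integral_unique => //; first exact: measure_of_M1.
move=> B e mB.
have -> : (fun x => \1_B x *: e) =
    \sum_(j < n) e ord0 j *: ((fun x => \1_B x *: delta_mx ord0 j) : rvec).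
  apply/funext => x; rewrite fct_sumE {1}(row_sum_delta e) scaler_sumr.
  by apply: eq_bigr => j _; rewrite fctE !scalerA mulrC.
have eL j : Linf P (e ord0 j *: ((fun x => \1_B x *: delta_mx ord0 j) : rvec)).
  by apply: (lin_closedZ _ Ll); exact: Linf_indic.
have [_ ->] := linear_on_sum (index_enum _) Ll f_linear eL.
apply: eq_bigr => j _; rewrite (linear_onZ _ Ll f_linear) ?mxE //.
exact: Linf_indic.
Qed.

Lemma exists_decomposition : top_dual P PP f ->
  exists y m w, [/\ Yspace P N PP y, Ms P N PP m, annihilator P PP w
                  & represents P N PP y m w f].
Proof.
move=> fD; have mM := measure_of_M1.
have [ma [ms [A [maM mac msM vA [ms0 mE]]]]] := yosida_hewitt mM.
have [y may] := countably_additive_density maM mac.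
have [yL _] := may; have [mAk _ _] := vA.
have fE v : Linf P v -> f v = pairing P y v + Linf_integral P N ms v.
  move=> vL; rewrite -Linf_integral_measure_of //.
  rewrite (@Linf_integral_comb _ _ _ P n N Nnorm 1 ma ms measure_of) // ?mul1r.
    by rewrite (Linf_integral_density Nnorm maM may).
  by move=> B mB; rewrite scale1r mE.
(* On L^oo the integral against [ms] is the limit of [f (restr v (A k))], and
   [r (restr v (A k)) <= r v] by (A3). *)
have ms_le v : Linf P v -> Linf_integral P N ms v <= L * fine (r v).
  move=> vL; have [_ [K vK]] := iffLR (LinfP P v) vL.
  apply: (@le_eps _ _ _ K) => e e0.
  have [k hk] := pairing_tail yL vL vK vA e0.
  have vAL := Linf_restr (mAk k) vL; have vCL := Linf_restr (measurableC (mAk k)) vL.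
  have -> : Linf_integral P N ms v = Linf_integral P N ms (restr v (A k)).
    rewrite {1}(restrC v (A k)) (linear_onD Ll (Linf_integral_lin Nnorm msM)) //.
    rewrite [X in _ + X](Linf_integral_null Nnorm msM (measurableC (mAk k))) ?addr0 //.
    exact: ms0.
  have := fE _ vAL; have := fr (LU vAL); move: hk.
  have : L * fine (r (restr v (A k))) <= L * fine (r v).
    rewrite ler_wpM2l // -lee_fin -!(sublinear_fine PPsub Pr) //.
    - exact: (sublinear_restr Nnorm PPsub PP3 Pr (mAk k) (LU vL)).
    - exact: LU.
    - exact: LU.
  by rewrite !ler_norml => h1 /andP[h2 h3] /andP[h4 h5] h6; lra.
have msp : (polar P N r ms < +oo)%E.
  apply: (@le_lt_trans _ _ L%:E); last exact: ltry.
  exact: (polar_le Nnorm PPsub PP2 Pr).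
(* On L^oo the integral against [ma] is [f] minus the integral against [ms], so their two bounds add
   up. *)
have map' : (polar P N r ma < +oo)%E.
  pose L' := L + fine (polar P N r ms).
  have p0 : 0 <= fine (polar P N r ms).
    by rewrite fine_ge0 // (polar_ge0 Nnorm PPsub Pr msM).
  apply: (@le_lt_trans _ _ L'%:E); last exact: ltry.
  apply: (polar_le Nnorm PPsub PP2 Pr); last by rewrite addr_ge0.
  move=> v vL; rewrite (Linf_integral_density Nnorm maM may) //.
  have := fE v vL; have := fr (LU vL).
  have : `|Linf_integral P N ms v| <= fine (polar P N r ms) * fine (r v).
    apply: (Linf_integral_polar Nnorm PPsub Pr msM msp vL).
    by rewrite -(sublinear_fine PPsub Pr (LU vL)).
  by rewrite /L' mulrDl !ler_norml => /andP[h1 h2] /andP[h3 h4] h5; lra.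
have yY : Yspace P N PP y by exists ma; split=> //; split=> //; exists r.
have msMs : Mspace P N PP ms by split=> //; exists r.
have [py yD] := Yspace_pairing yY; have msD := Mspace_dual msMs.
(* The remainder of [f], arranged so that two applications of [top_dual_comb] give its
   continuity. *)
exists y, ms, (fun u => -1 * pairing P y u + (-1 * integral_fa P N ms u + f u)).
split=> //.
- split=> //; split=> //; exists A; split=> // k.
  exact: (iffRL (abs_dual_eq0 Nnorm _ msM) (ms0 k)).
- split; first by apply: top_dual_comb => //; exact: top_dual_comb.
  by move=> u uL; rewrite integral_fa_Linf // fE //; ring.
- move=> u uU; rewrite pairingE; last exact: py.
  by rewrite -!EFinD; congr EFin; ring.
Qed.

End restriction.
End duality.

Theorem theorem7 (d : measure_display) (T : measurableType d) (R : realType)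
    (P : probability T R) (n : nat) (N : 'rV[R]_n -> R)
    (PP : set ((T -> 'rV[R]_n) -> \bar R)) :
  (0 < n)%N -> is_norm N ->
  (forall p, PP p -> sublinear_symmetric P p) ->
  A1 P N PP ->
  (forall p, PP p -> A2 P N p) ->
  (forall p, PP p -> A3 P N PP p) ->
  [/\ (* existence and uniqueness of the decomposition *)
      (directed P PP -> forall f, top_dual P PP f ->
        exists y m w, [/\ Yspace P N PP y, Ms P N PP m, annihilator P PP w
                        & represents P N PP y m w f])
      /\ (forall f y m w y' m' w',
        top_dual P PP f ->
        Yspace P N PP y -> Ms P N PP m -> annihilator P PP w ->
        represents P N PP y m w f ->
        Yspace P N PP y' -> Ms P N PP m' -> annihilator P PP w' ->
        represents P N PP y' m' w' f ->
        [/\ \forall x \ae P, y x = y' x,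
            forall B, measurable B -> m B = m' B
          & forall u, Uspace P PP u -> w u = w' u]),
      (* every triple defines an element of the dual *)
      forall y m w,
        Yspace P N PP y -> Ms P N PP m -> annihilator P PP w ->
        exists2 f, top_dual P PP f & represents P N PP y m w f,
      (* the integral of u is well defined, with the bound p(u) polar(p, m) *)
      forall u m, Uspace P PP u -> Mspace P N PP m ->
        dom P (rho P N m) u /\
        forall p, PP p -> (polar P N p m < +oo)%E ->
          ((integral_fa P N m u)%:E <= p u * polar P N p m)%E,
      forall w u, annihilator P PP w -> Uspace P PP u ->
        exists A : nat -> set T, vanishing P A /\
          forall k, Uspace P PP (restr u (A k)) /\ w u = w (restr u (A k))
    & ((forall p, PP p -> A4 P p) ->
        forall m, Ms P N PP m <-> forall B, measurable B -> m B = 0)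
      /\ ((forall p, PP p -> A5 P PP p) ->
        forall w, annihilator P PP w <->
          forall u, Uspace P PP u -> w u = 0)].
Proof.
move=> n0 Nnorm PPsub PP1 PP2 PP3; split.
- split=> [dir f fD|f y m w y' m' w' _].
    have [r [Pr [L L0 fr]]] := top_dual_dominated n0 Nnorm PPsub PP1 PP2 dir fD.
    have [fl _] := fD.
    exact: (exists_decomposition Nnorm PPsub PP2 PP3 fl Pr L0 fr fD).
  exact: decomposition_unique.
- exact: dual_of_triple.
- move=> u m uU [mM [q [Pq qm]]]; split.
    exact: (Uspace_dom_rho Nnorm PPsub PP3 Pq mM qm uU).
  move=> p Pp pm; exact: (integral_fa_le_polar Nnorm PPsub PP3 Pp mM pm uU).
- by move=> w u; exact: (annihilator_tail Nnorm PPsub PP3).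
- split; first exact: Ms_eq0.
  exact: (annihilator0 Nnorm PPsub PP2 PP3).
Qed.
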